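(* Let $M$ be an $m \times n$ totally unimodular matrix with columns $\bm{a}_1,\ldots,\bm{a}_n$ and $\max\{m,n\}\ge 3$. For all $\bm{b} \in \mathbb{Z}^m$ satisfying $\|\bm{b}\|_1 \ge 6m \cdot \log(\max\{m,n\})$ and such that $\#\{\bm{y} \in \mathbb{Z}_{\geq 0}^n \mid M\bm{y} = \bm{b}\} < \infty$, we have \[ \mathcal{E} \;\geq\; \#\{\bm{y} \in \mathbb{Z}_{\geq 0}^n \mid M\bm{y} = \bm{b}\} \;\geq\; e^{-\|\bm{b}\|_1}\, \mathcal{E}, \] where \[ \mathcal{E} = \inf_{\bm{x} > 0} \bm{x}^{-\bm{b}} \prod_{j=1}^n \sum_{k=0}^{\|\bm{b}\|_1} \bm{x}^{k \bm{a}_j}. \]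
   Context: A matrix is totally unimodular if all of its minors (determinants of all square submatrices) lie in $\{-1,0,1\}$. For $\bm{x}\in\mathbb{R}_{>0}^m$ and $\bm{a}\in\mathbb{Z}^m$, $\bm{x}^{\bm{a}}=\prod_{i=1}^m x_i^{a_i}$. The infimum is over $\bm{x}\in\mathbb{R}_{>0}^m$. $\|\bm{b}\|_1=\sum_i|b_i|$, and $\log$ is the natural logarithm. *)

(* Defs.v *)
From HB Require Import structures.
From mathcomp Require Import all_boot all_order all_algebra finmap.
From mathcomp Require Import boolp classical_sets functions cardinality.
From mathcomp Require Import reals sequences exp.

Set Implicit Arguments.
Unset Strict Implicit.
Unset Printing Implicit Defensive.

Import Order.TTheory GRing.Theory Num.Theory.

Local Open Scope classical_set_scope.
Local Open Scope ring_scope.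

(* A k x k submatrix is obtained by selecting k rows and k columns in
   increasing order, i.e. through two strictly increasing index maps. *)
Definition totally_unimodular (m n : nat) (M : 'M[int]_(m, n)) : Prop :=
  forall (k : nat) (f : 'I_k -> 'I_m) (g : 'I_k -> 'I_n),
    {homo f : i j / (i < j)%N} -> {homo g : i j / (i < j)%N} ->
    \det (mxsub f g M) \in [:: -1; 0; 1].

Definition l1norm (m : nat) (b : 'cV[int]_m) : nat :=
  (\sum_(i < m) `|b i ord0|)%N.

Definition nat_solutions (m n : nat) (M : 'M[int]_(m, n)) (b : 'cV[int]_m) :
    set 'cV[nat]_n :=
  [set y | M *m map_mx Posz y = b].

(* Meaningful only when the set of solutions is finite: fset_set sends an
   infinite set to the empty one. *)
Definition num_solutions (m n : nat) (M : 'M[int]_(m, n)) (b : 'cV[int]_m) :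
    nat :=
  #|` fset_set (nat_solutions M b)|%fset.

Definition monomial (R : realType) (m : nat) (x : 'cV[R]_m) (a : 'cV[int]_m) :
    R :=
  \prod_(i < m) x i ord0 ^ a i ord0.

Definition capacity (R : realType) (m n : nat) (M : 'M[int]_(m, n))
    (b : 'cV[int]_m) : R :=
  inf [set monomial x (- b) *
           \prod_(j < n) \sum_(0 <= k < (l1norm b).+1) monomial x (col j M *+ k)
      | x in [set x : 'cV[R]_m | forall i, 0 < x i ord0]].

(* Main.v *)
Require Import Defs.
From mathcomp Require Import boolp classical_sets cardinality reals sequences exp.
From mathcomp Require Import all_boot all_order all_algebra finmap perm.
From mathcomp Require Import lra zify ring.

Set Implicit Arguments.
Unset Strict Implicit.
Unset Printing Implicit Defensive.

Import Order.TTheory GRing.Theory Num.Theory.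
Local Open Scope ring_scope.

(** Write B = ||b||_1, and f(x) for the sum of x^(My - b) over y in [0,B]^n, so
    that E = inf f.  Rounding in the totally unimodular matrix [M | I] shows that
    finiteness confines the solutions to [0,B]^n, whence N <= E.

    For the lower bound let G_k be the number of k-tuples of points of [0,B]^n
    with average image b, so that N = G_1.  Two k-tuples with average image b
    together can be spliced into two k-tuples which both have average image b: a
    basic solution of the linear system is refined along a dyadic subdivision of
    the coordinates, with at most m undecided blocks at each scale, and the
    remaining m coordinates are rounded by unimodularity.  The splicing is
    recovered from few bits, so G_(2k) <= C_k G_k^2, and iterating gives
    G_k <= L^k with L = N (C(2m,m) 2^m)^(h+1) (B+1)^m, where m 2^h >= n.  Linear
    programming duality and the tensor-power trick turn this into E <= L, and
    L <= e^B N when n > 3m.  For n <= 3m already f(1) = (B+1)^n <= e^B. *)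

(** * Basic solutions and unimodular rounding *)

Definition lin_indep (F : fieldType) (m : nat) (T : finType)
    (a : T -> 'I_m -> F) (S : {set T}) :=
  forall v : T -> F, (forall j, j \notin S -> v j = 0) ->
    (forall l, \sum_j v j * a j l = 0) -> forall j, v j = 0.

Lemma lin_indep_row_free (F : fieldType) (m : nat) (T : finType)
    (a : T -> 'I_m -> F) (S : {set T}) :
  lin_indep a S ->
  row_free (\matrix_(i < #|S|, l < m) a (enum_val i) l).
Proof.
move=> indS; apply: inj_row_free => v vA0.
pose w j := if j \in S =P true is ReflectT jS then v ord0 (enum_rank_in jS j) else 0.
have wE i : w (enum_val i) = v ord0 i.
  rewrite /w; case: eqP => [jS|]; last by rewrite enum_valP.
  by rewrite enum_valK_in.
have wS j : j \notin S -> w j = 0.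
  by rewrite /w => /negbTE jS; case: eqP => // jS'; rewrite jS' in jS.
have w0 : forall j, w j = 0.
  apply: (indS w wS) => l.
  rewrite (bigID (mem S)) /= [X in _ + X]big1 ?addr0; last first.
    by move=> j jS; rewrite wS ?mul0r.
  rewrite big_enum_val /=.
  have /matrixP/(_ ord0 l) := vA0; rewrite !mxE => vA0l; rewrite -[RHS]vA0l.
  by apply: eq_bigr => i _; rewrite mxE wE.
by apply/rowP => i; rewrite mxE -wE w0.
Qed.

Lemma lin_indep_card (F : fieldType) (m : nat) (T : finType)
    (a : T -> 'I_m -> F) (S : {set T}) :
  lin_indep a S -> (#|S| <= m)%N.
Proof.
by move/lin_indep_row_free; rewrite /row_free => /eqP <-; exact: rank_leq_col.
Qed.

Definition fractional (R : numDomainType) (T : finType) (t : T -> R) : {set T} :=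
  [set j | 0 < t j < 1].

(* Moving along a linear dependency supported on the fractional coordinates
   until one of them reaches 0 or 1. *)
Lemma basic_solution (R : realFieldType) (m : nat) (T : finType)
    (a : T -> 'I_m -> R) (w t : T -> R) :
  (forall j, 0 <= t j <= 1) ->
  exists t' : T -> R,
    [/\ forall j, 0 <= t' j <= 1,
        forall j, j \notin fractional t -> t' j = t j,
        forall l, \sum_j t' j * a j l = \sum_j t j * a j l,
        \sum_j t' j * w j <= \sum_j t j * w j
      & lin_indep a (fractional t')].
Proof.
have [k] := ubnP #|fractional t|; elim: k t => // k IHk t.
rewrite ltnS => tk t01.
have [indt|] := pselect (lin_indep a (fractional t)).
  by exists t; split.
move=> /existsNP[v /not_implyP[vS /not_implyP[va0 /existsNP[j0 /eqP vj0]]]].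
(* Both [v] and [- v] are dependencies; the sign is chosen so that moving along [v] does not
   increase the objective. *)
wlog vw : v vS va0 vj0 / \sum_j v j * w j <= 0 => [hwlog|].
  have [vw|/ltW vw] := leP (\sum_j v j * w j) 0; first exact: (hwlog v).
  have sumN (b : T -> R) : \sum_j - v j * b j = - \sum_j v j * b j.
    by rewrite -sumrN; apply: eq_bigr => j _; rewrite mulNr.
  apply: (hwlog (fun j => - v j)) => [j jS|l||].
  - by rewrite vS ?oppr0.
  - by rewrite sumN va0 oppr0.
  - by rewrite oppr_eq0.
  - by rewrite sumN oppr_le0.
have suppF j : v j != 0 -> 0 < t j < 1.
  move=> vj; suff: j \in fractional t by rewrite inE.
  by apply: contraT => /vS vj'; rewrite vj' eqxx in vj.
(* Step length at which coordinate [j] reaches 1 or 0 along [v]; the minimum over the support of [v]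
   keeps every coordinate in [0, 1]. *)
pose s j := if 0 < v j then (1 - t j) / v j else - t j / v j.
have [j1 vj1 sj1] := @Order.TotalTheory.arg_minP _ _ _ j0 (fun j => v j != 0) s vj0.
pose e := s j1.
have e_ge0 : 0 <= e.
  rewrite /e /s; have /andP[t0 t1] := suppF _ vj1; case: ifPn => [v0|].
    by rewrite divr_ge0 ?subr_ge0 ?(ltW v0) ?(ltW t1).
  rewrite -leNgt => v0; rewrite mulNr -mulrN -invrN divr_ge0 ?(ltW t0) //.
  by rewrite oppr_ge0.
pose t1 j := t j + e * v j.
have t1_01 j : 0 <= t1 j <= 1.
  rewrite /t1; have [->|vj] := eqVneq (v j) 0; first by rewrite mulr0 addr0.
  have /andP[tj0 tj1] := suppF _ vj; have := sj1 _ vj; rewrite -/e /s.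
  have [v0|v0] := ltP 0 (v j).
    rewrite ler_pdivlMr // => h; have : 0 <= e * v j by rewrite mulr_ge0 // ltW.
    by move=> ?; apply/andP; split; lra.
  have {}v0 : v j < 0 by rewrite lt_neqAle vj.
  rewrite ler_ndivlMr // => h.
  have : e * v j <= 0 by rewrite mulr_ge0_le0 // ltW.
  by move=> ?; apply/andP; split; lra.
have t1E j : j \notin fractional t -> t1 j = t j.
  by move=> jF; rewrite /t1 vS // mulr0 addr0.
have t1j1 : j1 \notin fractional t1.
  rewrite inE /t1 /e /s; case: ifP => _; rewrite divfK //.
    by rewrite addrC subrK ltxx andbF.
  by rewrite subrr ltxx.
have sub : fractional t1 \proper fractional t.
  apply/properP; split.
    apply/fintype.subsetP => j; apply: contraLR => jF.
    by move: (jF); rewrite !inE t1E.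
  by exists j1 => //; rewrite inE suppF.
have lt1k : (#|fractional t1| < k)%N by apply: leq_trans tk; exact: proper_card.
have [t' [h1 h2 h3 h4 h5]] := IHk t1 lt1k t1_01.
have lin (b : T -> R) : \sum_j t1 j * b j = \sum_j t j * b j + e * \sum_j v j * b j.
  by rewrite mulr_sumr -big_split /=; apply: eq_bigr => j _; rewrite mulrDl mulrA.
exists t'; split => //.
- move=> j jF; rewrite h2 ?t1E //; apply: contra jF.
  by move/proper_sub/fintype.subsetP: sub => /(_ j).
- by move=> l; rewrite h3 lin va0 mulr0 addr0.
- by apply: le_trans h4 _; rewrite lin gerDl mulr_ge0_le0.
Qed.

(** The index maps are arbitrary rather than increasing, so that families with repeated members are
    covered, as the passage to [k]-tuples requires. *)
Definition unimodular_family (m : nat) (T : Type) (a : T -> 'cV[int]_m) :=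
  forall (k : nat) (f : 'I_k -> 'I_m) (g : 'I_k -> T),
    \det (\matrix_(i < k, j < k) a (g j) (f i) ord0) \in [:: -1; 0; 1].

Lemma unimodular_family_comp (m : nat) (T U : Type) (a : T -> 'cV[int]_m)
    (p : U -> T) :
  unimodular_family a -> unimodular_family (a \o p).
Proof. by move=> ua k f g; exact: (ua k f (p \o g)). Qed.

Lemma mem_pm1N (x : int) : (x \in [:: -1; 0; 1]) = (- x \in [:: -1; 0; 1]).
Proof. by apply/idP/idP; rewrite !inE; lia. Qed.

Lemma det_reindex (R : comPzRingType) (k : nat) (I J : Type) (A : I -> J -> R)
    (f : 'I_k -> I) (g : 'I_k -> J) (s : 'S_k) :
  \det (\matrix_(i, j) A (f (s i)) (g j)) = (-1) ^+ s * \det (\matrix_(i, j) A (f i) (g j)).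
Proof.
rewrite -det_perm -det_mulmx -row_permE; congr (\det _).
by apply/matrixP => i j; rewrite !mxE.
Qed.

Lemma inj_ord_increasing (k p : nat) (f : 'I_k -> 'I_p) : injective f ->
  exists (s : 'S_k) (f' : 'I_k -> 'I_p),
    {homo f' : i j / (i < j)%N} /\ f =1 f' \o s.
Proof.
move=> finj; pose S := [set f i | i : 'I_k].
have cardS : #|S| = k by rewrite card_imset // card_ord.
have fS i : f i \in S by exact: imset_f.
pose r i := cast_ord cardS (Order.enum_rank_in (fS i) (f i)).
have rinj : injective r.
  move=> i i' /cast_ord_inj /(congr1 Order.enum_val).
  by rewrite !Order.enum_rankK_in // => /finj.
exists (perm rinj), (fun i => Order.enum_val (cast_ord (esym cardS) i)); split; last first.
  by move=> i; rewrite /= permE cast_ordK Order.enum_rankK_in.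
move=> i j ij.
have := leW_mono (@Order.le_enum_val _ 'I_p (@le_total _ _) S) (cast_ord (esym cardS) i) (cast_ord (esym cardS) j).
by rewrite !ltEord => ->.
Qed.

(** A repeated row or column makes the determinant vanish; otherwise sorting the indices changes
    only its sign. *)
Lemma totally_unimodular_family (m n : nat) (M : 'M[int]_(m, n)) :
  totally_unimodular M -> unimodular_family (fun j => col j M).
Proof.
move=> tuM k f g.
have -> : (\matrix_(i < k, j < k) col (g j) M (f i) ord0) = \matrix_(i, j) M (f i) (g j).
  by apply/matrixP => i j; rewrite !mxE.
have [finj|/injectivePn[i [i' ii' fii']]] := boolP (injectiveb f); last first.
  by rewrite (determinant_alternate ii') // => j; rewrite !mxE fii'.
have [ginj|/injectivePn[i [i' ii' gii']]] := boolP (injectiveb g); last first.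
  by rewrite -det_tr (determinant_alternate ii') // => j; rewrite !mxE gii'.
have [s [f' [f'inc fE]]] := inj_ord_increasing (injectiveP _ finj).
have [t [g' [g'inc gE]]] := inj_ord_increasing (injectiveP _ ginj).
under eq_mx do rewrite fE gE /=.
rewrite (det_reindex (fun i j => M i j)) -det_tr.
have -> : (\matrix_(i, j) M (f' i) (g' (t j)))^T = \matrix_(i, j) M (f' j) (g' (t i)).
  by apply/matrixP => i j; rewrite !mxE.
rewrite (det_reindex (fun j i => M i j)) -det_tr.
have -> : (\matrix_(i, j) M (f' j) (g' i))^T = mxsub f' g' M.
  by apply/matrixP => i j; rewrite !mxE.
have := tuM k f' g' f'inc g'inc.
by case: (odd_perm s) (odd_perm t) => [] [];
  rewrite ?expr0 ?expr1 ?mul1r ?mulN1r ?opprK // -?mem_pm1N.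
Qed.

(** Independence provides rows forming an invertible square matrix. Its determinant is then 1 or -1,
    so its inverse is integral, and [t] on [S] solves a system with integral right-hand side. *)
Lemma unimodular_integral (R : archiRealFieldType) (m : nat) (T : finType)
    (a : T -> 'cV[int]_m) (S : {set T}) (t : T -> R) :
  unimodular_family a -> lin_indep (fun j l => (a j l ord0)%:~R : R) S ->
  (forall l, \sum_(j in S) t j * (a j l ord0)%:~R \is a Num.int) ->
  forall j, j \in S -> t j \is a Num.int.
Proof.
move=> ua /lin_indep_row_free; set V := (X in row_free X) => freeV tint j jS.
have fullV : row_full V^T by rewrite /row_full mxrank_tr.
pose f := fullrankfun fullV.
pose X0 : 'M[int]_#|S| := \matrix_(i, j) a (enum_val j) (f i) ord0.
have XE : rowsub f V^T = map_mx intr X0 by apply/matrixP => i i'; rewrite !mxE.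
have Xunit : map_mx (intr : int -> R) X0 \in unitmx.
  by rewrite -XE; exact: fullrowsub_unit.
have X0unit : X0 \in unitmx.
  rewrite unitmxE; have : \det X0 \in [:: -1; 0; 1] by exact: ua.
  move: Xunit; rewrite unitmxE det_map_mx unitfE intr_eq0 !inE.
  by move=> /negbTE -> /orP[/eqP->|/eqP->].
pose x : 'cV[R]_#|S| := \col_i t (enum_val i).
pose d : 'cV[int]_#|S| := \col_i Num.floor (\sum_(j in S) t j * (a j (f i) ord0)%:~R).
have xd : map_mx intr X0 *m x = map_mx intr d.
  apply/colP => i; rewrite !mxE floorK //.
  by rewrite [RHS]big_enum_val /=; apply: eq_bigr => i' _; rewrite !mxE mulrC.
have xE : x = map_mx intr (invmx X0 *m d).
  by rewrite map_mxM -xd mulmxA -map_mxM mulVmx // map_mx1 mul1mx.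
have -> : t j = x (enum_rank_in jS j) ord0 by rewrite mxE enum_rankK_in.
by rewrite xE mxE intr_int.
Qed.

(** The fractional parts of [z] are moved to a basic solution; its fractional coordinates would be
    integers by [unimodular_integral], so there are none. *)
Lemma unimodular_rounding (R : archiRealFieldType) (m : nat) (T : finType)
    (a : T -> 'cV[int]_m) (w z : T -> R) :
  unimodular_family a ->
  (forall l, \sum_j z j * (a j l ord0)%:~R \is a Num.int) ->
  exists z' : T -> int,
    [/\ forall j, `|(z' j)%:~R - z j| < 1,
        forall l, (\sum_j z' j * a j l ord0)%:~R = \sum_j z j * (a j l ord0)%:~R
      & \sum_j (z' j)%:~R * w j <= \sum_j z j * w j].
Proof.
move=> ua zint; pose aR j l : R := (a j l ord0)%:~R.
pose t j := z j - (Num.floor (z j))%:~R.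
have zE j : z j = (Num.floor (z j))%:~R + t j by rewrite addrC subrK.
have t01 j : 0 <= t j < 1.
  by have := floor_itv (z j); rewrite intrD => /andP[? ?]; apply/andP; split; rewrite /t; lra.
have t01' j : 0 <= t j <= 1 by case/andP: (t01 j) => -> /ltW ->.
have [t' [t'01 t'E t'a t'w indt']] := basic_solution aR w t01'.
have splitz (b : T -> R) (s : T -> R) :
    \sum_j ((Num.floor (z j))%:~R + s j) * b j =
    \sum_j (Num.floor (z j))%:~R * b j + \sum_j s j * b j.
  by rewrite -big_split /=; apply: eq_bigr => j _; rewrite mulrDl.
have zsum (b : T -> R) : \sum_j z j * b j =
    \sum_j (Num.floor (z j))%:~R * b j + \sum_j t j * b j.
  by rewrite -splitz; apply: eq_bigr => j _; rewrite -zE.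
have t'0or1 j : j \notin fractional t' -> t' j = 0 \/ t' j = 1.
  rewrite inE negb_and -!leNgt; have /andP[h0 h1] := t'01 j.
  by case/orP => h; [left|right]; apply/eqP; rewrite eq_le ?h ?h0 ?h1.
have t'int j : j \notin fractional t' -> t' j \is a Num.int.
  by case/t'0or1 => ->; rewrite ?rpred0 ?rpred1.
have frac0 j : j \notin fractional t'.
  apply/negP => jF; have : t' j \is a Num.int.
    apply: (unimodular_integral ua indt') jF => l.
    have -> : \sum_(j in fractional t') t' j * aR j l = \sum_j z j * aR j l
      - \sum_j (Num.floor (z j))%:~R * aR j l
      - \sum_(j | j \notin fractional t') t' j * aR j l.
      rewrite zsum -t'a (bigID (mem (fractional t')) predT (fun j => t' j * _)) /=.
      by lra.
    rewrite !rpredB ?zint ?rpred_sum // => [i _|i iF]; rewrite rpredM ?intr_int //.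
    exact: t'int.
  move: jF; rewrite inE => /andP[h0 h1] /intrP[x xE].
  by move: h0 h1; rewrite xE ltr0z ltrz1; lia.
exists (fun j => Num.floor (z j) + (t' j == 1)%:Z).
have z'E j : (Num.floor (z j) + (t' j == 1)%:Z)%:~R = (Num.floor (z j))%:~R + t' j.
  rewrite intrD; congr (_ + _); case: (t'0or1 j (frac0 j)) => ->.
    by rewrite eq_sym oner_eq0.
  by rewrite eqxx.
split.
- move=> j; rewrite z'E {2}(zE j) opprD addrACA subrr add0r ltr_norml.
  have [jF|jF] := boolP (j \in fractional t); last by rewrite t'E // subrr ltrN10 ltr01.
  move: jF; rewrite inE => /andP[h0 h1]; have /andP[h2 h3] := t'01 j.
  by apply/andP; split; lra.
- move=> l; rewrite rmorph_sum /= zsum -t'a -splitz.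
  by apply: eq_bigr => j _; rewrite intrM z'E.
- rewrite zsum; under eq_bigr do rewrite z'E.
  by rewrite splitz lerD2l.
Qed.

(** * Splitting families and halving *)

Lemma card_bigcup_le (I T : finType) (P : pred I) (F : I -> {set T}) :
  (#|\bigcup_(i | P i) F i| <= \sum_(i | P i) #|F i|)%N.
Proof.
elim/big_rec2: _ => [|i k S _ Sk]; first by rewrite cards0.
by apply: leq_trans (leq_add (leqnn _) Sk); rewrite cardsU leq_subr.
Qed.

Lemma superset_of_card (T : finType) (S : {set T}) (m : nat) :
  (#|S| <= m <= #|T|)%N -> exists2 A : {set T}, S \subset A & #|A| = m.
Proof.
elim: m => [|m IHm] /andP[Sm mT].
  by exists S => //; apply/eqP; rewrite -leqn0.
have [Sm'|Sm'] := eqVneq #|S| m.+1; first by exists S.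
have [|A SA cardA] := IHm; first by rewrite -ltnS ltn_neqAle Sm' Sm ltnW.
have /card_gt0P[x xA] : (0 < #|~: A|)%N.
  by rewrite -(leq_add2l #|A|) cardsC addn1 cardA.
exists (x |: A); first exact: (fintype.subset_trans SA (subsetUr _ _)).
by rewrite cardsU1 -in_setC xA cardA.
Qed.

Lemma oapp_sum (R : nzRingType) (T C : finType) (col : T -> option C) (t : C -> R)
    (w : T -> R) :
  \sum_j oapp t 0 (col j) * w j = \sum_c t c * \sum_(j | col j == Some c) w j.
Proof.
under [RHS]eq_bigr do rewrite big_distrr /= big_mkcond /=.
rewrite exchange_big /=; apply: eq_bigr => j _.
case: (col j) => [c|] /=; last by rewrite big1 ?mul0r.
by rewrite (bigD1 c) //= eqxx big1 ?addr0 // => c' /negbTE c'c; rewrite (inj_eq Some_inj) eq_sym c'c.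
Qed.

(* A pair (W, F) encodes the partial rounding which is 1 on W, 0 outside W and F
   and free on F.  Halving every colour class and passing to a basic solution
   leaves at most m of the 2m halves undecided, and only the list of undecided
   halves and of halves rounded up has to be recorded. *)
Lemma splitting_family (R : realFieldType) (m h : nat) (T C : finType)
    (col : T -> option C) (pos : T -> nat) :
  #|C| = m -> (forall j, (pos j < 2 ^ h)%N) ->
  (forall j j', col j -> col j = col j' -> pos j = pos j' -> j = j') ->
  exists Fam : {set {set T} * {set T}},
    [/\ (#|Fam| <= ('C(m.*2, m) * 2 ^ m) ^ h)%N,
        forall P, P \in Fam -> (#|P.2| <= m)%N,
        forall P, P \in Fam -> P.1 :|: P.2 \subset [set j | col j]
      & forall (w : T -> 'I_m -> R) (t : C -> R), (forall c, 0 <= t c <= 1) ->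
        exists P, exists tau : T -> R,
          [/\ P \in Fam, forall j, 0 <= tau j <= 1,
              forall j, j \notin P.2 -> tau j = (j \in P.1)%:R
            & forall l, \sum_j tau j * w j l = \sum_j oapp t 0 (col j) * w j l]].
Proof.
elim: h C col pos => [|h IHh] C col pos cardC pos_lt col_inj.
  (* At the finest scale a colour class has at most one element, so all coloured points can stay
     free. *)
  exists [set (set0, [set j | col j])]; split.
  - by rewrite cards1.
  - move=> P /set1P -> /=; rewrite -cardC.
    have [c0 _|C0] := pickP C; last first.
      rewrite (_ : [set j | col j] = set0) ?cards0 //.
      by apply/setP => j; rewrite !inE; case: (col j) => // c; have := C0 c.
    rewrite -(card_in_imset (f := fun j => odflt c0 (col j))) ?max_card //.
    move=> j j'; rewrite !inE => cj cj' cjj'; apply: col_inj => //.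
      by move: cj cj' cjj'; case: (col j) (col j') => [c|] [c'|] //= _ _ ->.
    have := pos_lt j; have := pos_lt j'; rewrite expn0 !ltnS !leqn0.
    by move=> /eqP -> /eqP ->.
  - by move=> P /set1P -> /=; rewrite set0U.
  - move=> w t t01; exists (set0, [set j | col j]), (fun j => oapp t 0 (col j)).
    split => //= [|j|j]; first by rewrite set11.
      by case: (col j) => //=; rewrite lexx ler01.
    by rewrite !inE; case: (col j).
(* The new colours are the halves of the old classes, cut at position [2 ^ h]; [colA A] uncolours
   every half outside [A]. *)
pose C2 := (C * bool)%type.
pose col2 j : option C2 := omap (fun c => (c, (pos j < 2 ^ h)%N)) (col j).
have card2 : #|{: C2}| = m.*2 by rewrite card_prod card_bool cardC muln2.
pose colA (A : {set C2}) j : option {c | c \in A} := obind insub (col2 j).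
pose pos' j := (pos j %% 2 ^ h)%N.
(* The guard [#|A| = m] lets [G] be chosen for all [A] at once; sets of another size receive the
   empty family. *)
have /fin_all_exists[G GP] : forall A : {set C2}, exists Fam : {set {set T} * {set T}},
    #|A| = m ->
    [/\ (#|Fam| <= ('C(m.*2, m) * 2 ^ m) ^ h)%N,
        forall P, P \in Fam -> (#|P.2| <= m)%N,
        forall P, P \in Fam -> P.1 :|: P.2 \subset [set j | colA A j]
      & forall (w : T -> 'I_m -> R) (t : {c | c \in A} -> R),
        (forall c, 0 <= t c <= 1) ->
        exists P, exists tau : T -> R,
          [/\ P \in Fam, forall j, 0 <= tau j <= 1,
              forall j, j \notin P.2 -> tau j = (j \in P.1)%:R
            & forall l, \sum_j tau j * w j l = \sum_j oapp t 0 (colA A j) * w j l]].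
  move=> A; have [cardA|] := eqVneq #|A| m; last first.
    by move=> /eqP cardA; exists set0.
  have [||j j'|Fam FamP] := IHh _ (colA A) pos'.
  - by rewrite card_sig -cardA; apply: eq_card => x; rewrite !inE.
  - by move=> j; rewrite ltn_mod expn_gt0.
  - rewrite /colA /col2 /pos'; case cj: (col j) => [c|] //=.
    case cj': (col j') => [c'|] /=; last by case: insub.
    case: insubP => //= x _ xE _; case: insubP => //= x' _ x'E [xx'] posE.
    have : (c, (pos j < 2 ^ h)%N) = (c', (pos j' < 2 ^ h)%N) by rewrite -xE -x'E xx'.
    case=> cc' bb'; apply: col_inj; rewrite ?cj ?cj' ?cc' //.
    move: posE bb' (pos_lt j) (pos_lt j'); rewrite expnS mul2n -addnn.
    set q := (2 ^ h)%N; have q0 : (0 < q)%N by rewrite expn_gt0.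
    case: ltnP => h1; case: ltnP => // h2; first by rewrite !modn_small.
    rewrite -{1}(subnK h1) -{1}(subnK h2) !modnDr => + _ h3 h4.
    by rewrite !modn_small ?ltn_subLR // => /(congr1 (addn^~ q)); rewrite !subnK.
  - by exists Fam.
(* [D] lists the halves rounded up, and [ext] adds their union to the part on which the rounding is
   1. *)
pose U (D : {set C2}) := [set j | oapp (fun c => c \in D) false (col2 j)].
pose ext (D : {set C2}) (P : {set T} * {set T}) := (P.1 :|: U D, P.2).
pose Fam := \bigcup_(A : {set C2} | #|A| == m)
  \bigcup_(D in powerset (~: A)) [set ext D P | P in G A].
have colA_sub A j : colA A j -> col j by rewrite /colA /col2; case: (col j).
have U_sub D j : j \in U D -> col j by rewrite inE /col2; case: (col j).
have FamP P : P \in Fam -> exists (A D : {set C2}) (Q : {set T} * {set T}), [/\ #|A| = m, Q \in G A & P = ext D Q].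
  case/bigcupP => A /eqP cardA /bigcupP[D _ /imsetP[Q QG ->]].
  by exists A, D, Q.
exists Fam; split.
- apply: leq_trans (card_bigcup_le _ _) _.
  apply: (@leq_trans (\sum_(A : {set C2} | #|A| == m) 2 ^ m * ('C(m.*2, m) * 2 ^ m) ^ h)).
    apply: leq_sum => A /eqP cardA; apply: leq_trans (card_bigcup_le _ _) _.
    have cardCA : #|~: A| = m by apply: (@addnI #|A|); rewrite cardsC card2 cardA addnn.
    set K := (_ ^ h)%N.
    have -> : (2 ^ m * K = \sum_(D in powerset (~: A)) K)%N.
      by rewrite sum_nat_const card_powerset cardCA.
    apply: leq_sum => D _; apply: leq_trans (leq_imset_card _ _) _.
    by have [] := GP A cardA.
  rewrite sum_nat_const -cardsE card_draws card2 expnS.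
  by rewrite mulnA.
- by move=> P /FamP[A [D [Q [cardA QG ->]]]] /=; have [_ + _ _] := GP A cardA; apply.
- move=> P /FamP[A [D [Q [cardA QG ->]]]] /=; apply/fintype.subsetP => j.
  have [_ _ /(_ Q QG)/fintype.subsetP/(_ j) Qsub _] := GP A cardA.
  rewrite in_set setUAC in_setU => /orP[/Qsub|/U_sub//].
  by rewrite in_set => /colA_sub.
move=> w t t01.
(* [t], copied to both halves of each class, is moved to a basic solution for the half sums [V]. Its
   at most [m] fractional halves are padded to a set [A] of exactly [m] halves, counted by
   ['C(m.*2, m)]. *)
pose V (c : C2) l := \sum_(j | col2 j == Some c) w j l.
have [t' [t'01 _ t'V _ indt']] :=
  @basic_solution R m _ V (fun=> 0) (fun c => t c.1) (fun c => t01 c.1).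
have [|A SA cardA] := @superset_of_card _ (fractional t') m.
  by rewrite (lin_indep_card indt') card2 -addnn leq_addr.
have t'0or1 c : c \notin A -> t' c = (t' c == 1)%:R.
  move=> cA; have : c \notin fractional t' by apply: contra cA; apply/fintype.subsetP.
  rewrite inE negb_and -!leNgt; have /andP[h0 h1] := t'01 c.
  case/orP => h2; first by rewrite (_ : t' c = 0) ?(eq_sym 0) ?oner_eq0 //; apply/le_anti/andP.
  by rewrite (_ : t' c = 1) ?eqxx //; apply/le_anti/andP.
pose D := [set c in ~: A | t' c == 1].
have [_ GF Gsub /(_ w (fun c => t' (val c)))[|Q [tau [QG tau01 tauE tauS]]]] := GP A cardA.
  by move=> c.
have UE j : (j \in U D)%:R + oapp (fun c : {c | c \in A} => t' (val c)) 0 (colA A j)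
    = oapp t' 0 (col2 j).
  rewrite inE /colA; case: (col2 j) => [c|] /=; last by rewrite addr0.
  rewrite !inE; case: insubP => [c' cA <-|cA] /=; first by rewrite (valP c') add0r.
  by rewrite cA addr0 -t'0or1.
have tauU j : j \in U D -> j \notin Q.1 :|: Q.2.
  move=> jU; apply/negP => jQ.
  have /fintype.subsetP/(_ j jQ) := Gsub Q QG; rewrite inE /colA.
  move: jU; rewrite inE; case: (col2 j) => // c /=.
  by rewrite !inE => /andP[cA _]; rewrite insubF //; apply/negbTE.
exists (ext D Q), (fun j => if j \in U D then 1 else tau j); split.
- apply/bigcupP; exists A; first exact/eqP.
  apply/bigcupP; exists D; last exact: imset_f.
  by rewrite powersetE; apply/fintype.subsetP => c; rewrite !inE => /andP[].
- by move=> j; case: ifP => // _; rewrite ler01 lexx.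
- move=> j /= jQ; rewrite !(in_setU); case: ifP => _; first by rewrite orbT.
  by rewrite orbF tauE.
- move=> l; transitivity (\sum_j ((j \in U D)%:R * w j l + tau j * w j l)).
    apply: eq_bigr => j _; case: ifP => [jU|_]; last by rewrite mul0r add0r.
    have := tauU j jU; rewrite in_setU negb_or => /andP[j1 j2].
    by rewrite (tauE _ j2) (negbTE j1) mul0r addr0.
  rewrite big_split /= tauS -big_split /=.
  under eq_bigr do rewrite -mulrDl UE.
  rewrite oapp_sum t'V; rewrite -(oapp_sum col2 (fun c => t c.1)).
  by apply: eq_bigr => j _; rewrite /col2; case: (col j).
Qed.

Definition box_sum (m B : nat) (T : finType) (a : T -> 'cV[int]_m)
    (y : {ffun T -> 'I_B.+1}) : 'cV[int]_m := \sum_j a j *+ y j.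

Lemma box_sumE (m B : nat) (T : finType) (a : T -> 'cV[int]_m)
    (y : {ffun T -> 'I_B.+1}) l :
  box_sum a y l ord0 = \sum_j (y j)%:Z * a j l ord0.
Proof.
rewrite summxE; apply: eq_bigr => j _.
by rewrite mulmxnE -mulr_natl natz.
Qed.

(* The pair (y, y') is spliced along W into a pair (z, z') of points of the fibre
   of c with z + z' = y + y'; only the values of y on F have to be stored to
   recover it from W, z and z'. *)
Lemma halving (m B h : nat) (T : finType) (a : T -> 'cV[int]_m) (c : 'cV[int]_m) :
  unimodular_family a -> (#|T| <= m * 2 ^ h)%N ->
  (#|[set yy : {ffun T -> 'I_B.+1} * {ffun T -> 'I_B.+1} |
      (box_sum a yy.1 + box_sum a yy.2 == c *+ 2)%R]| <=
   ('C(m.*2, m) * 2 ^ m) ^ h * B.+1 ^ m *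
   #|[set y : {ffun T -> 'I_B.+1} | box_sum a y == c]| ^ 2)%N.
Proof.
move=> ua cardT; set Pairs := [set yy | _]; set S := [set y | _].
pose box : predArgType := {ffun T -> 'I_B.+1}.
have q0 : (0 < 2 ^ h)%N by rewrite expn_gt0.
(* Blocks of [2 ^ h] consecutive ranks serve as the [m] colour classes. *)
have col_lt (j : T) : (enum_rank j %/ 2 ^ h < m)%N.
  by rewrite ltn_divLR //; apply: leq_trans (ltn_ord _) cardT.
have [||j j' _ [cc'] pp'|Fam [cardFam FamF _ FamP]] :=
  @splitting_family rat m h T 'I_m (fun j => Some (Ordinal (col_lt j)))
    (fun j => (enum_rank j %% 2 ^ h)%N).
- exact: card_ord.
- by move=> j; rewrite ltn_mod.
- apply/enum_rank_inj/val_inj.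
  by rewrite /= (divn_eq (enum_rank j) (2 ^ h)) cc' pp' -divn_eq.
pose spliced (P : {set T} * {set T}) (yy zz : box * box) :=
  [forall j, (zz.1 j + zz.2 j == yy.1 j + yy.2 j)%N &&
    ((j \notin P.2) ==> (yy.1 j == if j \in P.1 then zz.2 j else zz.1 j))].
pose Q P := [set yy : box * box | [exists zz, (zz \in setX S S) && spliced P yy zz]].
have PairsQ : Pairs \subset \bigcup_(P in Fam) Q P.
  apply/fintype.subsetP => -[y y']; rewrite inE /= => /eqP yy'.
  pose w j l : rat := ((y' j)%:R - (y j)%:R) * (a j l ord0)%:~R.
  have [|P [tau [PFam tau01 tauE tauS]]] := FamP w (fun=> 2^-1).
    by move=> _; rewrite invr_ge0 ler0n invf_le1 ?ltr0n // ler1n.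
  (* Moves from [y] towards [y'] by the fraction [tau]; as [tau] has the same sums against [w] as
     the constant 1/2, the image of [z0] is [c]. *)
  pose z0 j : rat := (y j)%:R + tau j * ((y' j)%:R - (y j)%:R).
  have z0c l : \sum_j z0 j * (a j l ord0)%:~R = (c l ord0)%:~R.
    have -> : \sum_j z0 j * (a j l ord0)%:~R =
        \sum_j (y j)%:R * (a j l ord0)%:~R + \sum_j tau j * w j l.
      by rewrite -big_split /=; apply: eq_bigr => j _; rewrite /z0 /w mulrDl mulrA.
    rewrite tauS /= -mulr_sumr.
    have -> : \sum_j w j l = \sum_j (y' j)%:R * (a j l ord0)%:~R
        - \sum_j (y j)%:R * (a j l ord0)%:~R.
      by rewrite -sumrB; apply: eq_bigr => j _; rewrite /w mulrBl.
    have sumE (x : box) : \sum_j (x j)%:R * (a j l ord0)%:~R = (box_sum a x l ord0)%:~R :> rat.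
      by rewrite box_sumE rmorph_sum /=; apply: eq_bigr => j _; rewrite intrM.
    rewrite !sumE; have := congr1 (fun v : 'cV[int]_m => (v l ord0)%:~R : rat) yy'.
    by rewrite !mxE !intrD => h2; lra.
  have [|z [zz0 za _]] := unimodular_rounding (fun=> 0) ua (z := z0).
    by move=> l; rewrite z0c intr_int.
  (* [z0 j] lies in an interval with integer ends and [z j] is at distance less than 1, so [z j]
     lies there too. Hence [z] and [y + y' - z] both stay in the box. *)
  have zbetween j : (minn (y j) (y' j))%:Z <= z j <= (maxn (y j) (y' j))%:Z.
    have : (minn (y j) (y' j))%:R <= z0 j <= (maxn (y j) (y' j))%:R.
      have /andP[t0 t1] := tau01 j; rewrite /z0.
      case: (leqP (y j) (y' j)) => [le|/ltnW le]; move: le; rewrite -(ler_nat rat) => le.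
        by apply/andP; split; nra.
      by apply/andP; split; nra.
    move: (zz0 j); rewrite ltr_norml => /andP[h1 h2] /andP[h3 h4].
    have : ((minn (y j) (y' j))%:Z - 1)%:~R < (z j)%:~R :> rat by rewrite intrB; lra.
    have : (z j)%:~R < ((maxn (y j) (y' j))%:Z + 1)%:~R :> rat by rewrite intrD; lra.
    by rewrite !ltr_int; lia.
  have z_ge0 j : 0 <= z j by have := zbetween j; lia.
  have zB j : (`|z j|%N < B.+1)%N by have := zbetween j; have := ltn_ord (y j); have := ltn_ord (y' j); lia.
  have z'B j : (y j + y' j - `|z j|%N < B.+1)%N.
    by have := zbetween j; have := ltn_ord (y j); have := ltn_ord (y' j); lia.
  pose Z : box := [ffun j => Ordinal (zB j)].
  pose Z' : box := [ffun j => Ordinal (z'B j)].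
  have ZZ' j : (Z j + Z' j = y j + y' j)%N.
    have zle : (`|z j|%N <= y j + y' j)%N by have := zbetween j; lia.
    by rewrite !ffunE /= subnKC.
  have Zc : box_sum a Z = c.
    apply/colP => l; rewrite box_sumE; apply: (@intr_inj rat); rewrite -z0c -za; congr (_%:~R).
    by apply: eq_bigr => j _; rewrite ffunE /= gez0_abs.
  have Z'c : box_sum a Z' = c.
    apply: (@addrI _ c); rewrite -[in LHS]Zc -mulr2n -yy' -!big_split /=.
    by apply: eq_bigr => j _; rewrite -!mulrnDr ZZ'.
  apply/bigcupP; exists P => //; rewrite inE; apply/existsP; exists (Z, Z').
  rewrite !inE /= Zc Z'c eqxx /=; apply/forallP => j /=; rewrite ZZ' eqxx /=.
  apply/implyP => jF; have := zz0 j; rewrite /z0 tauE //.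
  (* Off [P.2] the point [z0] is already integral, so rounding leaves it unchanged. *)
  have near (x : nat) : `|(z j)%:~R - x%:R : rat| < 1 -> `|z j|%N = x.
    rewrite -[x%:R]/(x%:Z%:~R) -intrB -intr_norm ltrz1; lia.
  have -> : (y j)%:R + (j \in P.1)%:R * ((y' j)%:R - (y j)%:R)
      = (if j \in P.1 then y' j else y j)%:R :> rat.
    by case: (j \in P.1) => /=; rewrite ?mulr1n ?mulr0n; ring.
  move/near => zj; apply/eqP/val_inj.
  by case: (j \in P.1) zj => zj; rewrite !ffunE /= zj ?addnK.
apply: leq_trans (subset_leq_card PairsQ) _.
apply: leq_trans (card_bigcup_le _ _) _.
rewrite -mulnA; apply: (@leq_trans (#|Fam| * (B.+1 ^ m * #|S| ^ 2))); last by rewrite leq_mul2r cardFam orbT.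
rewrite -sum_nat_const; apply: leq_sum => P PFam.
(* [u.1] carries the values of [y] on [P.2], at most [m] of them, whence the factor [B.+1 ^ m]; [y']
   then follows from [y + y' = z + z']. *)
pose restore (u : box * (box * box)) : box * box :=
  let y := [ffun j => if j \in P.2 then u.1 j else if j \in P.1 then u.2.2 j else u.2.1 j] in
  (y, [ffun j => inord (u.2.1 j + u.2.2 j - y j)]).
have QP : Q P \subset restore @: setX [set g in pffun_on ord0 P.2 predT] (setX S S).
  apply/fintype.subsetP => -[y y']; rewrite inE => /existsP[[z z'] /andP[zS /forallP spl]].
  apply/imsetP; exists ([ffun j => if j \in P.2 then y j else ord0], (z, z')).
    rewrite inE /= zS andbT inE; apply/pffun_onP; split => [|i /imageP[j _ ->] //].
    by apply/supportP => j jF; rewrite ffunE (negbTE jF).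
  have yE j : (if j \in P.2 then if j \in P.2 then y j else ord0
      else if j \in P.1 then z' j else z j) = y j.
    have /andP[_ /implyP yE] := spl j.
    by have [//|jF] := boolP (j \in P.2); rewrite (eqP (yE jF)).
  congr (_, _); apply/ffunP => j; rewrite !ffunE /= ?ffunE yE //.
  have /andP[/eqP /= -> _] := spl j.
  by rewrite addKn inord_val.
apply: leq_trans (subset_leq_card QP) _; apply: leq_trans (leq_imset_card _ _) _.
rewrite !cardsX cardsE card_pffun_on card_ord leq_mul // leq_pexp2l //.
exact: FamF.
Qed.

(** * Integral certificates and the tensor-power trick *)

(* Fourier-Motzkin elimination; the certificate stays integral because the
   vectors are. *)
Lemma integer_farkas (R : realFieldType) (m : nat) (I : finType)
    (d : I -> 'I_m -> int) (g : I -> R) :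
  (exists u : 'I_m -> R, forall i, g i + \sum_l u l * (d i l)%:~R <= 0) \/
  (exists lam : I -> nat, (forall l, \sum_i (lam i)%:Z * d i l = 0) /\
     0 < \sum_i (lam i)%:R * g i).
Proof.
elim: m I d g => [|m IHm] I d g.
  have [i0 gi0|gle] := pickP (fun i => 0 < g i).
    right; exists (fun i => (i == i0) : nat); split; first by case.
    rewrite (bigD1 i0) //= eqxx mul1r big1 ?addr0 // => i /negbTE ->.
    by rewrite mul0r.
  left; exists (fun=> 0) => i; rewrite big_ord0 addr0 leNgt.
  by have := gle i => /= ->.
pose d0 i := d i ord0.
(* Multipliers eliminating the first variable: a row without it is kept, two rows with opposite
   signs are combined so that it cancels, and all other indices give the zero row. *)
pose k (i' : I + I * I) (i : I) : nat := match i' with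
  | inl i0 => if d0 i0 == 0 then (i == i0)%N else 0
  | inr (p, q) => if (0 < d0 p) && (d0 q < 0)
      then (`|d0 q| * (i == p) + `|d0 p| * (i == q))%N else 0 end.
have sum1 (V : pzRingType) (f : I -> V) i0 : \sum_i (i == i0)%:R * f i = f i0.
  rewrite (bigD1 i0) //= eqxx mul1r big1 ?addr0 // => i /negbTE ->.
  by rewrite mul0r.
have suml (V : pzRingType) (f : I -> V) i0 :
    \sum_i (k (inl i0) i)%:R * f i = if d0 i0 == 0 then f i0 else 0.
  rewrite /=; case: ifP => _; first exact: sum1.
  by rewrite big1 // => i _; rewrite mul0r.
have sumr (V : pzRingType) (f : I -> V) p q :
    \sum_i (k (inr (p, q)) i)%:R * f i =
    if (0 < d0 p) && (d0 q < 0) then `|d0 q|%:R * f p + `|d0 p|%:R * f q else 0.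
  rewrite /=; case: ifP => _; last by rewrite big1 // => i _; rewrite mul0r.
  under eq_bigr do rewrite natrD !natrM mulrDl -!mulrA.
  by rewrite big_split /= -!mulr_sumr !sum1.
have [[u' u'P]|[lam [lam0 lamg]]] := IHm (I + I * I)%type
  (fun i' l => \sum_i (k i' i)%:R * d i (lift ord0 l))
  (fun i' => \sum_i (k i' i)%:R * g i).
  left; pose h i := g i + \sum_l u' l * (d i (lift ord0 l))%:~R.
  have khE i' : \sum_i (k i' i)%:R * g i +
      \sum_l u' l * (\sum_i (k i' i)%:R * d i (lift ord0 l))%:~R
      = \sum_i (k i' i)%:R * h i.
    under [RHS]eq_bigr do rewrite mulrDr mulr_sumr.
    rewrite big_split /= exchange_big /=; congr (_ + _); apply: eq_bigr => l _.
    rewrite rmorph_sum mulr_sumr; apply: eq_bigr => i _.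
    by rewrite rmorphM /= rmorph_nat mulrCA.
  have h0 i : d0 i = 0 -> h i <= 0.
    by move=> di; have := u'P (inl i); rewrite khE suml di eqxx.
  have hpq p q : 0 < d0 p -> d0 q < 0 -> `|d0 q|%:R * h p + `|d0 p|%:R * h q <= 0.
    by move=> dp dq; have := u'P (inr (p, q)); rewrite khE sumr dp dq.
  suff [x xP] : exists x : R, forall i, h i + x * (d0 i)%:~R <= 0.
    exists (fun l => if unlift ord0 l is Some l' then u' l' else x) => i.
    rewrite big_ord_recl unlift_none.
    under eq_bigr do rewrite liftK.
    by rewrite addrCA addrC -/(h i).
  have absR q : d0 q < 0 -> `|d0 q|%:R = - (d0 q)%:~R :> R.
    by move=> dq; rewrite -[LHS]/(`|d0 q|%N%:Z%:~R) (ltz0_abs dq) rmorphN.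
  have absR' p : 0 < d0 p -> `|d0 p|%:R = (d0 p)%:~R :> R.
    by move=> dp; rewrite -[LHS]/(`|d0 p|%N%:Z%:~R) (gtz0_abs dp).
  (* Rows with [d0 > 0] bound [x] above and rows with [d0 < 0] bound it below, compatibly by [hpq].
     Take the smallest upper bound, failing that the largest lower bound, failing both 0. *)
  have [p0 dp0|noP] := pickP (fun p => 0 < d0 p).
    have [p dp pmin] := @arg_minP _ _ _ p0 (fun p => 0 < d0 p) (fun p => - h p / (d0 p)%:~R) dp0.
    exists (- h p / (d0 p)%:~R) => i; have dpR : 0 < (d0 p)%:~R :> R by rewrite ltr0z.
    case: (ltgtP (d0 i) 0) => di; last by rewrite di mulr0 addr0 h0.
      have := hpq _ _ dp di; rewrite absR // absR' // => hpi.
      rewrite -(pmulr_rle0 _ dpR) mulrDr !mulrA [_ * (- h p)]mulrC.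
      by rewrite mulfK ?gt_eqF //; lra.
    have := pmin i di; rewrite ler_pdivlMr ?ltr0z //; lra.
  have [q0 dq0|noQ] := pickP (fun q => d0 q < 0).
    have [q dq qmax] := @arg_maxP _ _ _ q0 (fun q => d0 q < 0) (fun q => - h q / (d0 q)%:~R) dq0.
    exists (- h q / (d0 q)%:~R) => i; have dqR : (d0 q)%:~R < 0 :> R by rewrite ltrz0.
    case: (ltgtP (d0 i) 0) => di; last by rewrite di mulr0 addr0 h0.
      have : - h i / (d0 i)%:~R <= - h q / (d0 q)%:~R := qmax i di; rewrite ler_ndivrMr ?ltrz0 //; lra.
    by have := noP i; rewrite di.
  exists 0 => i; rewrite mul0r addr0; apply: h0; apply/eqP.
  by case: (ltgtP (d0 i) 0) => // di; [have := noQ i | have := noP i]; rewrite di.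
right; exists (fun i => \sum_i' lam i' * k i' i)%N.
have lamE (V : pzRingType) (f : I -> V) :
    \sum_i (\sum_i' lam i' * k i' i)%:R * f i =
    \sum_i' (lam i')%:R * \sum_i (k i' i)%:R * f i.
  under eq_bigr do rewrite natr_sum mulr_suml.
  rewrite exchange_big /=; apply: eq_bigr => i' _.
  by rewrite mulr_sumr; apply: eq_bigr => i _; rewrite natrM mulrA.
split; last by rewrite lamE.
move=> l; under eq_bigr do rewrite -natz.
rewrite lamE; case: (unliftP ord0 l) => [l' ->|->].
  by rewrite -[RHS](lam0 l'); apply: eq_bigr => i' _; rewrite natz.
rewrite big1 // => -[i0|[p q]] _.
  by rewrite suml -/(d0 i0); case: eqP => [->|]; rewrite ?mulr0.
rewrite sumr -/(d0 p) -/(d0 q); case: ifP => [/andP[dp dq]|]; last by rewrite mulr0.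
by rewrite !natz (gtz0_abs dp) (ltz0_abs dq) /d0; ring.
Qed.

(** * Counting tuples with a prescribed sum *)

Definition sum_count (V : zmodType) (Om : finType) (d : Om -> V) (k : nat) (c : V) : nat :=
  #|[set Y : k.-tuple Om | \sum_(y <- Y) d y == c]|.

Section SumCount.
Variables (V : zmodType) (Om : finType) (d : Om -> V).

Lemma sum_count0 : sum_count d 0 0 = 1%N.
Proof.
rewrite /sum_count (_ : [set _ | _] = [set [tuple]]) ?cards1 //.
by apply/setP => Y; rewrite !inE tuple0 big_nil eqxx; apply/esym/eqP/val_inj.
Qed.

Lemma leq_sum_countD k k' c c' :
  (sum_count d k c * sum_count d k' c' <= sum_count d (k + k') (c + c'))%N.
Proof.
pose cat2 (YY : k.-tuple Om * k'.-tuple Om) := [tuple of YY.1 ++ YY.2].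
rewrite -cardsX -(card_imset _ (f := cat2)).
  apply: subset_leq_card; apply/fintype.subsetP => Z /imsetP[[Y Y']].
  by rewrite !inE /= => /andP[/eqP <- /eqP <-] ->; rewrite big_cat.
move=> [Y Y'] [Z Z'] /(congr1 val) /= /eqP; rewrite eqseq_cat ?size_tuple //.
by case/andP => /eqP/val_inj -> /eqP/val_inj ->.
Qed.

Lemma leq_sum_countX k c s :
  (sum_count d k c ^ s <= sum_count d (k * s) (c *+ s))%N.
Proof.
elim: s => [|s IHs]; first by rewrite muln0 mulr0n sum_count0.
rewrite expnS mulnS mulrS; apply: leq_trans (leq_sum_countD _ _ _ _).
by rewrite leq_mul2l IHs orbT.
Qed.

Lemma leq_sum_count_prod k (I : Type) (r : seq I) (c : I -> V) (s : I -> nat) :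
  (\prod_(i <- r) sum_count d k (c i) ^ s i <=
   sum_count d (k * \sum_(i <- r) s i) (\sum_(i <- r) c i *+ s i))%N.
Proof.
elim: r => [|i r IHr]; first by rewrite !big_nil muln0 sum_count0.
rewrite !big_cons mulnDr; apply: leq_trans (leq_sum_countD _ _ _ _).
by rewrite leq_mul // leq_sum_countX.
Qed.

(** If a count exceeded [q = L ^ k], concatenation would raise the count at a large power of two to
    at least [(q + 1) ^ s], while the hypothesis allows at most [q ^ (s + 1)]; this fails once
    [s > q ^ 2]. *)
Lemma sum_count_bound (L : nat) : (0 < sum_count d 1 0)%N ->
  (forall t, sum_count d (2 ^ t) 0 <= L ^ (2 ^ t))%N ->
  forall k, (sum_count d k 0 <= L ^ k)%N.
Proof.
move=> c1 cL [|k]; first by rewrite sum_count0 expn0.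
have L0 : (0 < L)%N by have := cL 0; rewrite expn0 expn1; exact: leq_trans.
set q := (L ^ k.+1)%N; have q0 : (0 < q)%N by rewrite expn_gt0 L0.
have cpos r : (0 < sum_count d r 0)%N.
  have := leq_sum_countX 1 0 r; rewrite mul1n mul0rn; apply: leq_trans.
  by rewrite expn_gt0 c1.
rewrite leqNgt; apply/negP => qc.
(* A power of two large enough for [s > q ^ 2]; the remainder modulo [k.+1] is filled by a zero-sum
   tuple, which exists by [cpos]. *)
pose N := (2 ^ (k.+1 * (q ^ 2).+1))%N; pose s := (N %/ k.+1)%N.
have sq : (q ^ 2 < s)%N by rewrite leq_divRL // mulnC ltnW // ltn_expl.
have h1 : (q.+1 ^ s <= q ^ s.+1)%N.
  apply: leq_trans (_ : sum_count d N 0 <= _)%N.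
    have -> : N = (k.+1 * s + N %% k.+1)%N by rewrite mulnC -divn_eq.
    rewrite -[0](addr0 (0 : V)); apply: leq_trans (leq_sum_countD _ _ _ _).
    rewrite -[X in (X <= _)%N]muln1 leq_mul //.
    rewrite -[0](mul0rn _ s); apply: leq_trans (leq_sum_countX _ _ _).
    by rewrite leq_exp2r // (leq_ltn_trans _ sq).
  apply: leq_trans (cL _) _; have -> : (q ^ s.+1 = L ^ (k.+1 * s.+1))%N by rewrite expnM.
  rewrite leq_pexp2l // -/N.
  by rewrite mulnC ltnW // ltn_ceil.
(* Bernoulli's inequality [1 + s / q <= (1 + 1 / q) ^ s], cleared of denominators. *)
have h2 : ((q + s) * q ^ s <= q * q.+1 ^ s)%N.
  elim: (s) => [|s' IHs]; first by rewrite !expn0 !muln1 addn0.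
  rewrite !expnS; apply: (@leq_trans ((q + s') * q ^ s' * q.+1)); last first.
    by rewrite mulnCA [X in (_ <= X)%N]mulnC leq_mul2r IHs orbT.
  rewrite mulnCA [X in (_ <= X)%N]mulnC mulnA [X in (_ <= X)%N]mulnA leq_mul2r; apply/orP; right; nia.
have : ((q + s) * q ^ s <= q * q ^ s.+1)%N by apply: leq_trans h2 _; rewrite leq_mul2l h1 orbT.
rewrite expnS mulnA leq_mul2r expn_eq0 -leqn0 leqNgt q0 /= mulnn.
by move=> /(leq_trans (leq_addl _ _)); rewrite leqNgt sq.
Qed.

End SumCount.

(** For [k = (m + 1) l], taking [(m + 1)]-st roots leaves a linear function of [l] to compare with
    [1 + (l ln rho) ^ 2 / 2]. *)
Lemma exp_beats_poly (R : realType) (rho : R) (C m : nat) : 1 < rho ->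
  exists k, ((k * C + 1) ^ m)%:R < rho ^+ k.
Proof.
move=> rho1; have rho0 : 0 < rho := lt_trans ltr01 rho1.
have l0 : 0 < ln rho by rewrite ln_gt0.
pose l := (Num.bound ((2 * m.+1 * C)%:R / ln rho ^+ 2)).+1.
have lP : (2 * m.+1 * C)%:R < l%:R * ln rho ^+ 2.
  rewrite -ltr_pdivrMr ?exprn_gt0 //; apply: lt_trans (archi_boundP _) _.
    by rewrite divr_ge0 // exprn_ge0 // ltW.
  by rewrite ltr_nat.
exists (m.+1 * l)%N; set b := (_ * C + 1)%N.
apply: (@le_lt_trans _ _ (b%:R ^+ m.+1)); first by rewrite -natrX ler_nat leq_pexp2l // /b addn1.
rewrite mulnC exprM ltrXn2r //.
apply: (@lt_le_trans _ _ (1 + (l%:R * ln rho) ^+ 2 / 2)); last first.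
  rewrite -[rho in leRHS](lnK rho0) -expRM_natl.
  by apply: (expR_ge1Dxn 1); rewrite mulr_ge0 // ltW.
rewrite /b natrD addrC ltrD2l ltr_pdivlMr // exprMn -natrM.
have -> : (m.+1 * l * C * 2)%:R = l%:R * (2 * m.+1 * C)%:R :> R by rewrite -natrM; congr _%:R; nia.
by rewrite expr2 -mulrA ltr_pM2l // ltr0n.
Qed.

Lemma sum_tuple_prod (R : comPzSemiRingType) (I : finType) (k : nat) (g : I -> R) :
  \sum_(Y : k.-tuple I) \prod_(y <- Y) g y = (\sum_y g y) ^+ k.
Proof.
rewrite -[k in RHS]card_ord -prodr_const bigA_distr_bigA /=.
rewrite (reindex (fun f : {ffun 'I_k -> I} => [tuple f i | i < k])) /=.
  by apply: eq_bigr => f _; rewrite big_map big_enum.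
exists (fun Y => [ffun i => tnth Y i]) => [f _|Y _].
  by apply/ffunP => i; rewrite ffunE tnth_mktuple.
by apply: eq_from_tnth => i; rewrite tnth_mktuple ffunE.
Qed.

Lemma ln_prod (R : realType) (I : Type) (r : seq I) (P : pred I) (f : I -> R) :
  (forall i, P i -> 0 < f i) ->
  ln (\prod_(i <- r | P i) f i) = \sum_(i <- r | P i) ln (f i).
Proof.
move=> f0; rewrite -[RHS]expRK expR_sum; congr ln.
by apply: eq_bigr => i Pi; rewrite lnK // posrE f0.
Qed.

Definition dot (R : realType) (m : nat) (u : 'I_m -> R) (v : 'cV[int]_m) : R :=
  \sum_l u l * (v l ord0)%:~R.

Lemma dot_sum (R : realType) (m : nat) (u : 'I_m -> R) (I : Type) (r : seq I)
    (P : pred I) (v : I -> 'cV[int]_m) :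
  dot u (\sum_(i <- r | P i) v i) = \sum_(i <- r | P i) dot u (v i).
Proof.
rewrite /dot exchange_big /=; apply: eq_bigr => l _.
by rewrite summxE rmorph_sum mulr_sumr.
Qed.

(* Tensor-power trick: at level k the polynomial many values of the sum of d
   over k-tuples cost a factor that disappears after taking k-th roots. *)
Lemma sum_count_capacity (R : realType) (m : nat) (Om : finType)
    (d : Om -> 'cV[int]_m) (L : nat) (E : R) :
  (0 < L)%N -> (forall k, sum_count d k 0 <= L ^ k)%N ->
  (forall u, E <= \sum_y expR (dot u (d y))) -> E <= L%:R.
Proof.
move=> L0 cL Ele; have LR : 0 < L%:R :> R by rewrite ltr0n.
rewrite leNgt; apply/negP => LE; have E0 : 0 < E := lt_trans LR LE.
pose X := (\sum_y \sum_l `|d y l ord0|)%N.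
have [|k] := @exp_beats_poly R (E / L%:R) (2 * X) m; first by rewrite ltr_pdivlMr ?mul1r.
apply/negP; rewrite -leNgt expr_div_n ler_pdivrMr ?exprn_gt0 //.
pose D (Y : k.-tuple Om) := \sum_(y <- Y) d y.
have count_pos Y : (0 < sum_count d k (D Y))%N.
  by apply/card_gt0P; exists Y; rewrite inE.
(* A solution [u] bounds the count times [expR (dot u (D Y))] by [L ^ k] for every [Y]. A
   certificate [lam] is impossible: concatenating tuples with these multiplicities gives zero sum,
   and their number would exceed the bound [cL]. *)
pose g Y : R := ln (sum_count d k (D Y))%:R - ln (L%:R ^+ k).
have [[u uP]|[lam [lam0 lamg]]] := integer_farkas (fun Y l => D Y l ord0) g; last first.
  exfalso; move: lamg; apply/negP; rewrite -leNgt.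
  have h : (\prod_(Y : k.-tuple Om) sum_count d k (D Y) ^ lam Y <= L ^ (k * \sum_Y lam Y))%N.
    apply: leq_trans (cL _); apply: leq_trans (leq_sum_count_prod _ _ _ _ _) _.
    rewrite (_ : \sum_Y _ = 0) //; apply/matrixP => l j; rewrite ord1 summxE mxE -[RHS](lam0 l).
    by apply: eq_bigr => Y _; rewrite mulmxnE -mulr_natl natz.
  have : ln (\prod_(Y : k.-tuple Om) (sum_count d k (D Y))%:R ^+ lam Y : R)
      <= ln (L%:R ^+ (k * \sum_Y lam Y)).
    rewrite ler_ln ?posrE ?exprn_gt0 //.
      by move: h; rewrite -(ler_nat R) natrX natr_prod; under eq_bigr do rewrite natrX.
    by apply: prodr_gt0 => Y _; rewrite exprn_gt0 // ltr0n.
  rewrite lnXn // ln_prod; last by move=> Y _; rewrite exprn_gt0 // ltr0n.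
  have -> : \sum_Y ln ((sum_count d k (D Y))%:R ^+ lam Y : R)
      = \sum_Y (lam Y)%:R * ln (sum_count d k (D Y))%:R.
    by apply: eq_bigr => Y _; rewrite lnXn ?ltr0n // mulr_natl.
  have -> : \sum_Y (lam Y)%:R * g Y = \sum_Y (lam Y)%:R * ln (sum_count d k (D Y))%:R
      - (k * \sum_Y lam Y)%:R * ln L%:R.
    rewrite natrM mulrAC natr_sum mulr_sumr -sumrB; apply: eq_bigr => Y _.
    by rewrite /g lnXn // -[ln _ *+ k]mulr_natl; ring.
  by rewrite subr_le0 [_ * ln L%:R]mulr_natl.
have countE Y : (sum_count d k (D Y))%:R * expR (dot u (D Y)) <= L%:R ^+ k.
  have : ln (sum_count d k (D Y))%:R + dot u (D Y) <= ln (L%:R ^+ k).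
    by have := uP Y; rewrite /g /dot; lra.
  by rewrite -[_ + _ <= _]ler_expR expRD !lnK ?posrE ?exprn_gt0 ?ltr0n.
have DX Y l : (`|D Y l ord0| <= k * X)%N.
  rewrite /D summxE; apply: (@leq_trans (\sum_(y <- Y) `|d y l ord0|)).
    elim/big_rec2: _ => // y a b _ ab.
    have tri (e f : int) : (`|(e + f)%R| <= `|e| + `|f|)%N by lia.
    by apply: leq_trans (tri _ _) _; rewrite leq_add2l.
  apply: (@leq_trans (\sum_(y <- Y) X)).
    apply: leq_sum => y _; rewrite /X (bigD1 y) //= (bigD1 l) //= -addnA leq_addr //.
  by rewrite big_const_seq count_predT size_tuple iter_addn_0 mulnC.
(* The coordinates of [D Y] lie in [[-kX, kX]]; shifted by [kX] they show that [D] takes at most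
   [(2kX + 1) ^ m] values. *)
pose p (Y : k.-tuple Om) : {ffun 'I_m -> 'I_(k * (2 * X)).+1} :=
  [ffun l => inord `|D Y l ord0 + (k * X)%:Z|].
have pD Y Y' : p Y = p Y' -> D Y = D Y'.
  move=> /ffunP pp; apply/colP => l; have := congr1 val (pp l); rewrite !ffunE /=.
  have arith (e : int) : (`|e| <= k * X)%N ->
      (`|(e + (k * X)%:Z)%R| < (k * (2 * X)).+1)%N /\ `|(e + (k * X)%:Z)%R|%N%:Z = e + (k * X)%:Z.
    by rewrite mulnCA; lia.
  have [lt1 e1] := arith _ (DX Y l); have [lt2 e2] := arith _ (DX Y' l).
  by rewrite !inordK // => /(congr1 Posz); rewrite e1 e2 => /addIr.
apply: (@le_trans _ _ ((\sum_y expR (dot u (d y))) ^+ k)).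
  by rewrite lerXn2r ?nnegrE ?(ltW E0) // (le_trans (ltW E0)).
rewrite -sum_tuple_prod.
under eq_bigr do rewrite -expR_sum -dot_sum.
rewrite (partition_big p predT) //=.
have -> : ((k * (2 * X) + 1) ^ m)%:R * L%:R ^+ k
    = \sum_(q : {ffun 'I_m -> 'I_(k * (2 * X)).+1}) L%:R ^+ k :> R.
  by rewrite sumr_const card_ffun !card_ord addn1 mulr_natl.
apply: ler_sum => q _; have [Y0 /eqP pY0|noY] := pickP (fun Y => p Y == q); last first.
  by rewrite big_pred0 // exprn_ge0.
apply: le_trans (countE Y0).
under eq_bigr => Y /eqP pY do rewrite -/(D Y) (pD Y Y0) ?pY ?pY0 //.
rewrite sumr_const -[leLHS]mulr_natl; apply: ler_wpM2r; rewrite ?expR_ge0 ?ler_nat //.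
apply: subset_leq_card; apply/fintype.subsetP => Y; move=> Yq; have pY : p Y = q by apply/eqP.
by rewrite inE; apply/eqP/pD; rewrite pY pY0.
Qed.

(** * Tuples of box points *)

Section BoxCount.
Variables (m B : nat) (T : finType) (a : T -> 'cV[int]_m) (b : 'cV[int]_m).
Let Om : finType := {ffun T -> 'I_B.+1}.
Let d (y : Om) : 'cV[int]_m := box_sum a y - b.

(** With every column repeated [k] times, a [k]-tuple of box points becomes one box point, so
    [halving] applies to tuples. *)
Definition rows (k : nat) (p : 'I_k * T) := a p.2.

Definition flat (k : nat) (Y : k.-tuple Om) : {ffun 'I_k * T -> 'I_B.+1} :=
  [ffun p => tnth Y p.1 p.2].

Lemma flat_inj k : injective (@flat k).
Proof.
move=> Y Y' /ffunP YY'; apply: eq_from_tnth => i; apply/ffunP => j.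
by have := YY' (i, j); rewrite !ffunE.
Qed.

Lemma box_sum_flat k (Y : k.-tuple Om) :
  box_sum (@rows k) (flat Y) = \sum_(y <- Y) box_sum a y.
Proof.
rewrite /box_sum big_tuple pair_big /=; apply: eq_bigr => -[i j] _.
by rewrite ffunE.
Qed.

Lemma sum_box_sumB k (Y : k.-tuple Om) :
  \sum_(y <- Y) d y = \sum_(y <- Y) box_sum a y - b *+ k.
Proof. by rewrite sumrB big_const_seq count_predT size_tuple iter_addr_0. Qed.

Lemma card_flat k :
  #|[set y : {ffun 'I_k * T -> 'I_B.+1} | box_sum (@rows k) y == b *+ k]| = sum_count d k 0.
Proof.
rewrite /sum_count -(card_imset _ (@flat_inj k)); apply: eq_card => y.
rewrite inE; apply/idP/imsetP => [yb|[Y]]; last first.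
  by rewrite inE sum_box_sumB subr_eq0 => /eqP Yb ->; rewrite box_sum_flat Yb.
have yE : y = flat [tuple [ffun j => y (i, j)] | i < k].
  by apply/ffunP => -[i j]; rewrite ffunE tnth_mktuple ffunE.
exists [tuple [ffun j => y (i, j)] | i < k] => //.
by rewrite inE sum_box_sumB subr_eq0 -box_sum_flat -yE.
Qed.

(** The two halves of a [2k]-tuple, flattened, form a pair as in [halving] over the fibre of
    [b *+ k]. *)
Lemma sum_count_double k h : unimodular_family a -> (k * #|T| <= m * 2 ^ h)%N ->
  (sum_count d (k + k) 0 <=
   ('C(m.*2, m) * 2 ^ m) ^ h * B.+1 ^ m * sum_count d k 0 ^ 2)%N.
Proof.
move=> ua kT; rewrite -(card_flat k).
have uk : unimodular_family (@rows k) by exact: unimodular_family_comp.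
apply: leq_trans (halving B (b *+ k) uk (h := h) _); last first.
  by rewrite card_prod card_ord.
pose half1 (Y : (k + k).-tuple Om) := [tuple tnth Y (lshift k i) | i < k].
pose half2 (Y : (k + k).-tuple Om) := [tuple tnth Y (rshift k i) | i < k].
pose halves Y := (flat (half1 Y), flat (half2 Y)).
rewrite /sum_count -(card_imset _ (f := halves)).
  apply: subset_leq_card; apply/fintype.subsetP => yy /imsetP[Y].
  rewrite !inE sum_box_sumB subr_eq0 => /eqP Yb -> /=; rewrite !box_sum_flat -mulrnA muln2 -addnn -Yb.
  rewrite [eqbRHS]big_tuple big_split_ord !big_tuple /=; apply/eqP.
  by congr (_ + _); apply: eq_bigr => i _; rewrite tnth_mktuple.
move=> Y Y' [] /flat_inj/(congr1 (fun Z => tnth Z)) h1 /flat_inj/(congr1 (fun Z => tnth Z)) h2.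
apply: eq_from_tnth => i; case: (split_ordP i) => i' ->.
  by have := congr1 (@^~ i') h1; rewrite !tnth_mktuple.
by have := congr1 (@^~ i') h2; rewrite !tnth_mktuple.
Qed.

(** The number of columns doubles with each step, so step [i] costs [K ^ (h + i)]. After normalising
    by [2 ^ t], the exponents [(h + i) / 2 ^ (i + 1)] add up to at most [h + 1]. *)
Lemma sum_count_pow2 h t : unimodular_family a -> (#|T| <= m * 2 ^ h)%N ->
  (sum_count d (2 ^ t) 0 <=
   (('C(m.*2, m) * 2 ^ m) ^ h.+1 * B.+1 ^ m * sum_count d 1 0) ^ (2 ^ t))%N.
Proof.
move=> ua hT; set K := ('C(_, m) * _)%N; set Q := (B.+1 ^ m)%N.
have K0 : (0 < K)%N by rewrite muln_gt0 bin_gt0 expn_gt0 -addnn leq_addr.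
have Q0 : (0 < Q)%N by rewrite expn_gt0.
(* With this prefactor the halving inequality says that each term is at most the
   square of the previous one. *)
suff : (K ^ (h + t).+1 * Q * sum_count d (2 ^ t) 0 <=
    (K ^ h.+1 * Q * sum_count d 1 0) ^ (2 ^ t))%N.
  by apply: leq_trans; rewrite leq_pmull // muln_gt0 expn_gt0 K0.
elim: t => [|t IHt]; first by rewrite addn0.
have -> : (2 ^ t.+1 = 2 ^ t + 2 ^ t)%N by rewrite expnS mul2n addnn.
rewrite [leqRHS]expnD; apply: leq_trans (leq_mul IHt IHt).
have := @sum_count_double (2 ^ t) (h + t) ua; rewrite -/K -/Q => dbl.
apply: leq_trans (leq_mul (leqnn _) (dbl _)) _.
  by rewrite expnD mulnA [leqLHS]mulnC leq_mul2r hT orbT.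
rewrite addnS !expnS; move: (K ^ (h + t))%N (sum_count _ _ _) => k0 c.
by rewrite expn0 !muln1; apply/eq_leq; ring.
Qed.

Lemma box_count_capacity (R : realType) (h : nat) (E : R) :
  unimodular_family a -> (#|T| <= m * 2 ^ h)%N -> (0 < sum_count d 1 0)%N ->
  (forall u, E <= \sum_y expR (dot u (d y))) ->
  E <= (('C(m.*2, m) * 2 ^ m) ^ h.+1 * B.+1 ^ m * sum_count d 1 0)%:R.
Proof.
move=> ua hT c1; apply: sum_count_capacity.
  by rewrite !muln_gt0 !expn_gt0 c1 !muln_gt0 bin_gt0 expn_gt0 -addnn leq_addr.
by apply: sum_count_bound => // t; exact: sum_count_pow2.
Qed.

End BoxCount.

(** * Lattice points and the capacity *)

Lemma sum_count1 (V : zmodType) (Om : finType) (d : Om -> V) (c : V) :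
  sum_count d 1 c = #|[set y | d y == c]|.
Proof.
rewrite /sum_count -[RHS](card_imset _ (f := fun y => [tuple y])) => [|y y' []//].
apply: eq_card => Y; case/tupleP: Y => y Y; rewrite tuple0 inE /= big_seq1.
apply/idP/imsetP => [dy|[y' + /(congr1 val) /= [->]]]; last by rewrite inE.
by exists y; rewrite ?inE //; apply: val_inj.
Qed.

(** Farkas with the constant [K] leaves two cases: some [u] makes all terms at most [expR (- K)],
    too small for a positive [E]; or a weighted average of box points has image [b], and rounding it
    gives a point of the empty fibre. *)
Lemma box_count0_capacity (R : realType) (m B : nat) (T : finType)
    (a : T -> 'cV[int]_m) (b : 'cV[int]_m) (E : R) :
  unimodular_family a -> #|[set y : {ffun T -> 'I_B.+1} | box_sum a y == b]| = 0%N ->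
  (forall u, E <= \sum_(y : {ffun T -> 'I_B.+1}) expR (dot u (box_sum a y - b))) ->
  E <= 0.
Proof.
pose Om : finType := {ffun T -> 'I_B.+1}.
move=> ua noy Ele.
rewrite leNgt; apply/negP => E0.
(* Chosen so that [#|{: Om}|%:R * expR (- K) < E], because [K < 1 + K <= expR K]. *)
pose K : R := #|{: Om}|%:R / E.
have [[u uP]|[lam [lam0 lamK]]] :=
  integer_farkas (fun (y : Om) l => (box_sum a y - b) l ord0) (fun=> K).
  have := Ele u; apply/negP; rewrite -ltNge.
  apply: (@le_lt_trans _ _ (\sum_(y : Om) expR (- K))).
    by apply: ler_sum => y _; rewrite ler_expR; have := uP y; rewrite /dot; lra.
  rewrite sumr_const -mulr_natl expRN ltr_pdivrMr ?expR_gt0 // mulrC.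
  rewrite -ltr_pdivrMr // -/K; apply: lt_le_trans (expR_ge1Dx K).
  by rewrite ltrDr.
pose S : R := \sum_y (lam y)%:R.
have S0 : 0 < S.
  rewrite lt_neqAle sumr_ge0 // andbT eq_sym; apply/eqP => S0.
  by move: lamK; rewrite -mulr_suml -/S S0 mul0r ltxx.
pose z j : R := (\sum_(y : Om) (lam y)%:R * (y j)%:R) / S.
have zint l : \sum_j z j * (a j l ord0)%:~R = (b l ord0)%:~R.
  have boxR (y : Om) : (box_sum a y l ord0)%:~R = \sum_j (y j)%:R * (a j l ord0)%:~R :> R.
    by rewrite box_sumE rmorph_sum /=; apply: eq_bigr => i _; rewrite intrM.
  have lamR : \sum_(y : Om) (lam y)%:R * (box_sum a y l ord0)%:~R = S * (b l ord0)%:~R :> R.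
    apply/eqP; rewrite -subr_eq0 /S mulr_suml -sumrB; apply/eqP.
    rewrite -[RHS]/(0%:~R) -(lam0 l) rmorph_sum /=; apply: eq_bigr => y _.
    by rewrite !mxE intrM intrB -[(lam y)%:~R]/((lam y)%:R); ring.
  apply: (mulfI (lt0r_neq0 S0)); rewrite -lamR mulr_sumr.
  under [RHS]eq_bigr do rewrite boxR mulr_sumr.
  rewrite exchange_big /=; apply: eq_bigr => i _.
  under eq_bigr do rewrite mulrA.
  by rewrite -mulr_suml mulrA mulrCA divff ?mulr1 // lt0r_neq0.
have [|z' [zz' z'a _]] := unimodular_rounding (fun=> 0) ua (z := z).
  by move=> l; rewrite zint intr_int.
have z_ge0 j : 0 <= z j.
  by rewrite divr_ge0 ?(ltW S0) // sumr_ge0 // => y _; rewrite mulr_ge0.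
have z_leB j : z j <= B%:R.
  rewrite ler_pdivrMr // /S mulr_sumr; apply: ler_sum => y _.
  by rewrite mulrC ler_wpM2r // ler_nat -ltnS ltn_ord.
have z'0 j : 0 <= z' j.
  have := zz' j; rewrite ltr_norml => /andP[h _].
  have : (-1)%:~R < (z' j)%:~R :> R by rewrite rmorphN1; have := z_ge0 j; lra.
  by rewrite ltr_int; lia.
have z'B j : (`|z' j|%N < B.+1)%N.
  have := zz' j; rewrite ltr_norml => /andP[_ h].
  have : (z' j)%:~R < (B%:Z + 1)%:~R :> R by rewrite intrD; have := z_leB j; lra.
  by rewrite ltr_int; have := z'0 j; lia.
suff : [ffun j => Ordinal (z'B j)] \in [set y : Om | box_sum a y == b].
  by move: noy => /eqP; rewrite cards_eq0 => /eqP ->; rewrite inE.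
rewrite inE; apply/eqP/colP => l; apply: (@intr_inj R).
rewrite box_sumE -zint -z'a; congr (_%:~R).
by apply: eq_bigr => j _; rewrite ffunE /= gez0_abs.
Qed.

(** Expansion along a unit column leaves, up to sign, a smaller minor of the same kind, or 0. *)
Lemma unimodular_family_unit (m : nat) (T : Type) (a : T -> 'cV[int]_m) :
  unimodular_family a ->
  unimodular_family (fun x : T + 'I_m =>
    match x with inl j => a j | inr i => \col_l (l == i)%:R end).
Proof.
move=> ua k; elim: k => [|k IHk] f g; first by rewrite det_mx00.
set A := \matrix_(_, _) _.
have [[j0 [i0 gj0]]|noinr] := pselect (exists j0 i0, g j0 = inr i0).
  have [finj|/injectivePn[i [i' ii' fii']]] := boolP (injectiveb f); last first.
    by rewrite (determinant_alternate ii') // => j; rewrite !mxE fii'.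
  have Aj0 i : A i j0 = (f i == i0)%:R by rewrite mxE gj0 mxE.
  rewrite (expand_det_col A j0).
  have [i1 /eqP fi1|noi] := pickP (fun i => f i == i0); last first.
    by rewrite big1 // => i _; rewrite Aj0 noi mul0r.
  rewrite (bigD1 i1) //= Aj0 fi1 eqxx mul1r big1 ?addr0 => [|i ii1]; last first.
    by rewrite Aj0 -fi1 (inj_eq (injectiveP _ finj)) (negbTE ii1) mul0r.
  have := IHk (f \o lift i1) (g \o lift j0).
  rewrite /cofactor; set A1 := \matrix_(_, _) _; have -> : row' i1 (col' j0 A) = A1.
    by apply/matrixP => i j; rewrite !mxE.
  by rewrite -signr_odd; case: odd; rewrite ?expr0 ?expr1 ?mul1r ?mulN1r // -mem_pm1N.
have /choice[g' g'E] : forall j, exists t, g j = inl t.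
  by move=> j; case gj: (g j) => [t|i]; [exists t | case: noinr; exists j, i].
have -> : A = \matrix_(i, j) a (g' j) (f i) ord0.
  by apply/matrixP => i j; rewrite !mxE g'E.
exact: ua.
Qed.

(* If y j were larger, rounding y / y j, with unit columns recording - b / y j,
   would produce a nonnegative integral kernel vector of M which is 1 at j. *)
Lemma solution_bound (R : realType) (m n : nat) (M : 'M[int]_(m, n)) (b : 'cV[int]_m)
    (y : 'cV[nat]_n) (j : 'I_n) :
  totally_unimodular M -> finite_set (nat_solutions M b) ->
  nat_solutions M b y -> (y j ord0 <= l1norm b)%N.
Proof.
move=> /totally_unimodular_family/unimodular_family_unit.
set a := (a in unimodular_family a) => ua Sfin Sy; rewrite leqNgt; apply/negP => yj.
pose N : R := (y j ord0)%:R; have N0 : 0 < N by rewrite ltr0n (leq_ltn_trans _ yj).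
pose z (x : 'I_n + 'I_m) : R :=
  match x with inl i => (y i ord0)%:R / N | inr l => - (b l ord0)%:~R / N end.
(* This objective is the 1-norm of the unit part at [z], where it equals [l1norm b / N < 1]. *)
pose w (x : 'I_n + 'I_m) : R :=
  match x with inl i => 0 | inr l => - (sgz (b l ord0))%:~R end.
have sumT (V : nmodType) (f : 'I_n + 'I_m -> V) :
    \sum_x f x = \sum_i f (inl i) + \sum_l f (inr l) by rewrite big_sumType.
have za l : \sum_x z x * (a x l ord0)%:~R = 0.
  rewrite sumT /= [X in _ + X](bigD1 l) //= mxE eqxx mulr1 [X in _ + (_ + X)]big1 => [|i il]; last first.
    by rewrite mxE eq_sym (negbTE il) mulr0.
  rewrite addr0 mulNr -{1}Sy mxE rmorph_sum mulr_suml -sumrB big1 // => i _.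
  by rewrite !mxE /= intrM -[(Posz _)%:~R]/((y i ord0)%:R) mulrAC [_ * _%:R]mulrC subrr.
have wz : \sum_x z x * w x < 1.
  rewrite sumT /= big1 => [|i _]; last by rewrite mulr0.
  have absE l : z (inr l) * w (inr l) = `|b l ord0|%N%:R / N.
    rewrite /= mulrN mulNr mulNr opprK mulrAC -intrM mulrC mulrC; congr (_ / _).
    by rewrite -[RHS]/(`|b l ord0|%N%:Z%:~R) mulrC -normrEsg.
  under eq_bigr => l _ do rewrite absE.
  by rewrite add0r -mulr_suml -natr_sum ltr_pdivrMr // mul1r ltr_nat.
have [|z' [zz' z'a z'w]] := unimodular_rounding w ua (z := z).
  by move=> l; rewrite za rpred0.
have bN l : `|(b l ord0)%:~R / N| < 1.
  rewrite normf_div (gtr0_norm N0) ltr_pdivrMr // mul1r -intr_norm -abszE ltr_nat.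
  by apply: leq_ltn_trans yj; rewrite /l1norm (bigD1 l) //= leq_addr.
have gtN1 (e : int) : (-1)%:~R < e%:~R :> R -> 0 <= e by rewrite ltr_int; lia.
have lt1 (e : int) : e%:~R < 1%:~R :> R -> e <= 0 by rewrite ltr_int; lia.
have z'l i : 0 <= z' (inl i).
  have := zz' (inl i); rewrite ltr_norml => /andP[h _].
  have z0 : 0 <= z (inl i) by rewrite /z divr_ge0 ?(ltW N0).
  by apply: gtN1; rewrite rmorphN1; lra.
have z'j : z' (inl j) = 1.
  have := zz' (inl j); rewrite /= divff ?lt0r_neq0 // -[X in _ - X]/(1%:~R) -intrB -intr_norm.
  by rewrite ltrz1; lia.
(* Rounding cannot reverse the sign of [- b / N], so [p l] is the absolute value of [z' (inr l)].
   These nonnegative integers have sum below 1, hence the unit part of [z'] vanishes. *)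
pose p l := - sgz (b l ord0) * z' (inr l).
have bl_cases l : [\/ b l ord0 = 0 /\ z' (inr l) = 0,
    sgz (b l ord0) = 1 /\ z' (inr l) <= 0 | sgz (b l ord0) = -1 /\ 0 <= z' (inr l)].
  have := zz' (inr l); rewrite /= ltr_norml => /andP[h1 h2].
  have [b0|b0|b0] := ltgtP (b l ord0) 0.
  - constructor 3; split; first exact: ltr0_sgz.
    apply: gtN1; have : 0 < - (b l ord0)%:~R / N by rewrite divr_gt0 // oppr_gt0 ltrz0.
    by rewrite rmorphN1; lra.
  - constructor 2; split; first exact: gtr0_sgz.
    apply: lt1; have : 0 < (b l ord0)%:~R / N by rewrite divr_gt0 // ltr0z.
    by rewrite mulNr in h2; lra.
  - constructor 1; split => //; move: h1 h2; rewrite b0 mulr0z oppr0 mul0r !subr0.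
    by rewrite -(rmorphN1 (intr : int -> R)) => /gtN1 h1 /lt1 h2; apply/le_anti/andP.
have p_ge0 l : 0 <= p l by rewrite /p; case: (bl_cases l) => -[-> ?] //; rewrite ?sgz0; lia.
have sump : \sum_l p l < 1.
  rewrite -(ltrz1 R) rmorph_sum; apply: le_lt_trans wz; apply: le_trans z'w.
  rewrite sumT /= [X in _ <= X + _]big1 ?add0r => [|i _]; last by rewrite mulr0.
  by apply: ler_sum => l _; rewrite /p intrM rmorphN /= mulrC.
have p0 l : p l = 0.
  apply/eqP; rewrite eq_le p_ge0 andbT -ltzD1 add0r; apply: le_lt_trans sump.
  by rewrite (bigD1 l) //= lerDl sumr_ge0.
have z'r l : z' (inr l) = 0.
  have := p0 l; rewrite /p; case: (bl_cases l) => -[-> ?] //.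
    by rewrite mulN1r => /eqP; rewrite oppr_eq0 => /eqP.
  by rewrite opprK mul1r.
pose v : 'cV[nat]_n := \col_i `|z' (inl i)|%N.
have Mv : M *m map_mx Posz v = 0.
  apply/colP => l; have /eqP := z'a l; rewrite za intr_eq0 sumT /= => /eqP.
  rewrite [X in _ + X]big1 ?addr0 => [za0|i _]; last by rewrite z'r mul0r.
  rewrite [RHS]mxE -[RHS]za0 mxE; apply: eq_bigr => i _.
  by rewrite !mxE gez0_abs // mulrC.
(* As [v] is 1 at [j], these are infinitely many distinct solutions. *)
pose f k : 'cV[nat]_n := y + v *+ k.
have fS k : nat_solutions M b (f k).
  rewrite /nat_solutions /= (_ : map_mx Posz (f k) = map_mx Posz y + map_mx Posz v *+ k).
    by rewrite mulmxDr raddfMn /= Mv mul0rn addr0.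
  apply/matrixP => i i'; rewrite !mxE mulmxnE [in RHS]mulmxnE [in RHS]mxE PoszD.
  have PoszMn (x : nat) : Posz (x *+ k) = Posz x *+ k.
    by elim: k => // k' IHk'; rewrite !mulrS PoszD IHk'.
  by rewrite PoszMn.
have finj : injective f.
  move=> k k' /(congr1 (fun x : 'cV[nat]_n => x j ord0)).
  by rewrite !mxE !mulmxnE !mxE z'j; lia.
have : finite_set (f @^-1` nat_solutions M b)%classic.
  by apply: finite_preimage => // k k' _ _; exact: finj.
rewrite (_ : (_ @^-1` _)%classic = [set: nat]%classic); last by apply/seteqP; split => // k _; exact: fS.
by apply/infiniteP; exact: card_lexx.
Qed.

(** * The capacity as an infimum of exponential sums, through [x = expR u] *)

Lemma dotB (R : realType) (m : nat) (u : 'I_m -> R) (v w : 'cV[int]_m) :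
  dot u (v - w) = dot u v - dot u w.
Proof.
rewrite /dot -sumrB; apply: eq_bigr => l _.
by rewrite !mxE rmorphB mulrBr.
Qed.

Lemma dot0 (R : realType) (m : nat) (u : 'I_m -> R) : dot u 0 = 0.
Proof. by rewrite -(subrr 0) dotB subrr. Qed.

Lemma expR_intmul (R : realType) (x : R) (k : int) : expR x ^ k = expR (x * k%:~R).
Proof.
case: k => k; first by rewrite -exprnP -expRM_natr.
by rewrite NegzE -exprnN rmorphN mulrN expRN expRM_natr.
Qed.

Lemma monomial_expR (R : realType) (m : nat) (u : 'I_m -> R) (v : 'cV[int]_m) :
  monomial (\col_l expR (u l)) v = expR (dot u v).
Proof.
rewrite /monomial /dot expR_sum; apply: eq_bigr => l _.
by rewrite mxE expR_intmul.
Qed.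

Section Capacity.
Variables (R : realType) (m n : nat) (M : 'M[int]_(m, n)) (b : 'cV[int]_m).
Let B := l1norm b.
Let Om : finType := {ffun 'I_n -> 'I_B.+1}.
Let a j := col j M.

Lemma capacity_expand (u : 'I_m -> R) (x := \col_l expR (u l)) :
  monomial x (- b) *
    \prod_(j < n) \sum_(0 <= k < B.+1) monomial x (col j M *+ k) =
  \sum_(y : Om) expR (dot u (box_sum a y - b)).
Proof.
have dotN : dot u (- b) = - dot u b by rewrite -sub0r dotB dot0 sub0r.
rewrite monomial_expR dotN; under eq_bigr do rewrite big_mkord.
rewrite bigA_distr_bigA mulr_sumr; apply: eq_bigr => y _.
under eq_bigr do rewrite monomial_expR.
by rewrite -expR_sum -dot_sum -expRD addrC -dotB.
Qed.

Lemma capacity_lbound : has_lbound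
  [set monomial x (- b) *
       \prod_(j < n) \sum_(0 <= k < B.+1) monomial x (col j M *+ k)
    | x in [set x : 'cV[R]_m | forall i, 0 < x i ord0]]%classic.
Proof.
have mono_ge0 (x : 'cV[R]_m) v : (forall i, 0 < x i ord0) -> 0 <= monomial x v.
  by move=> x0; apply: prodr_ge0 => l _; rewrite exprz_ge0 // ltW.
exists 0 => _ [x x0 <-]; rewrite mulr_ge0 ?mono_ge0 //.
by apply: prodr_ge0 => j _; apply: sumr_ge0 => k _; exact: mono_ge0.
Qed.

Lemma capacity_le (u : 'I_m -> R) :
  capacity R M b <= \sum_(y : Om) expR (dot u (box_sum a y - b)).
Proof.
rewrite -capacity_expand; apply: ge_inf; first exact: capacity_lbound.
by exists (\col_l expR (u l)) => //= l; rewrite mxE expR_gt0.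
Qed.

Lemma le_capacity (c : R) :
  (forall u, c <= \sum_(y : Om) expR (dot u (box_sum a y - b))) ->
  c <= capacity R M b.
Proof.
move=> cle; apply: lb_le_inf.
  by eexists; exists (const_mx 1) => //= i; rewrite mxE.
move=> _ [x x0 <-].
have -> : x = \col_l expR (ln (x l ord0)).
  by apply/colP => l; rewrite mxE lnK // posrE.
by rewrite capacity_expand.
Qed.

(** Each point of the fibre contributes exactly 1, and the other terms are nonnegative. *)
Lemma card_box_le (u : 'I_m -> R) :
  #|[set y : Om | box_sum a y == b]|%:R <= \sum_(y : Om) expR (dot u (box_sum a y - b)).
Proof.
rewrite (bigID (fun y => box_sum a y == b)) /= -[leLHS]addr0 lerD //; last first.
  by apply: sumr_ge0 => y _; exact: expR_ge0.
rewrite -sum1_card natr_sum; under eq_bigl do rewrite inE.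
by apply: ler_sum => y /eqP ->; rewrite subrr dot0 expR0.
Qed.

(** By [solution_bound] no solution lies outside the box. *)
Lemma num_solutionsE : totally_unimodular M -> finite_set (nat_solutions M b) ->
  num_solutions M b = #|[set y : Om | box_sum a y == b]|.
Proof.
move=> tuM fin.
pose phi (y : Om) : 'cV[nat]_n := \col_j (y j : nat).
have phi_inj : injective phi.
  move=> y y' /colP yy'; apply/ffunP => j; apply: val_inj.
  by have := yy' j; rewrite !mxE.
have phiS y : (box_sum a y == b) = (M *m map_mx Posz (phi y) == b).
  congr (_ == _); apply/colP => l; rewrite box_sumE mxE.
  by apply: eq_bigr => j _; rewrite !mxE mulrC.
rewrite /num_solutions (_ : fset_set _ =
    [fset phi y | y in [set y : Om | box_sum a y == b]]%fset).
  by rewrite card_imfset //= -cardE.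
apply/fsetP => y; rewrite in_fset_set //; apply/idP/imfsetP => [|[x /= + ->]]; last first.
  by rewrite inE phiS => /eqP xS; apply/mem_set.
move=> /set_mem Sy.
have yB j : (y j ord0 < B.+1)%N by rewrite ltnS (solution_bound R j tuM fin Sy).
have yE : y = phi [ffun j => Ordinal (yB j)].
  by apply/colP => j; rewrite mxE ffunE.
by exists [ffun j => Ordinal (yB j)]; rewrite //= inE phiS -yE; apply/eqP.
Qed.

End Capacity.

(** * Numerical estimates *)

(** The tangent inequality [1 + (s - L) <= expR (s - L)], with [expR L] in the denominator relaxed
    to [c]. *)
Lemma le_expR_tangent (R : realType) (s c L : R) :
  0 < c -> c <= expR L -> s <= expR s / c - 1 + L.
Proof.
move=> c0 cL; have := expR_ge1Dx (s - L); rewrite expRD expRN => h.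
have : expR s / expR L <= expR s / c by rewrite ler_wpM2l ?expR_ge0 // lef_pV2 ?posrE ?expR_gt0.
lra.
Qed.

(** Reduces numerical lower bounds for [expR] to rational arithmetic. *)
Lemma expR_pow_le (R : realType) (c x : R) (k : nat) :
  0 <= x -> c <= (1 + x / k.+1%:R) ^+ k.+1 -> c <= expR x.
Proof.
move=> x0 /le_trans; apply; rewrite -{2}(divfK (_ : k.+1%:R != 0) x) ?pnatr_eq0 //.
rewrite expRM_natr lerXn2r ?nnegrE ?expR_ge0 ?expR_ge1Dx //.
by rewrite addr_ge0 // divr_ge0.
Qed.

(** For [s = B / (2n)] and [n <= expR s] this yields [B + 1 <= expR (B / n)]. *)
Lemma expR_bound3 (R : realType) (s : R) : 3 <= expR s ->
  2 * s * expR s + 1 <= expR s ^+ 2.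
Proof.
(* [6/5] exceeds [ln 3]: already [(1 + (6/5) / 8) ^ 8 >= 3]. The argument 7 stands for the exponent
   8. *)
move=> a3; have e3 : 3 <= expR (6/5 : R).
  apply: (@expR_pow_le _ _ _ 7); first lra.
  by rewrite !exprS expr0; lra.
have := @le_expR_tangent R s 3 (6/5) ltac:(lra) e3.
by rewrite expr2; nra.
Qed.

(** Serves [m = 1], where [3 * m < n] forces [n >= 4]; [expR_bound7] serves [m >= 2], where
    [n >= 7]. In both, [s] stands for [B / (6m)]. *)
Lemma expR_bound4 (R : realType) (s : R) : 4 <= expR s ->
  16 * (6 * s + 1) <= expR s ^+ 4.
Proof.
move=> a4; have e4 : 4 <= expR (3/2 : R).
  apply: (@expR_pow_le _ _ _ 9); first lra.
  by rewrite !exprS expr0; lra.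
have := @le_expR_tangent R s 4 (3/2) ltac:(lra) e4.
have : 64 * expR s <= expR s ^+ 4 by rewrite exprSr ler_wpM2r ?expR_ge0 // !exprS expr0; nra.
by lra.
Qed.

Lemma expR_bound7 (R : realType) (s : R) : 7 <= expR s ->
  16 * (6 * s + 1) <= expR s ^+ 3.
Proof.
move=> a7; have e7 : 7 <= expR (5/2 : R).
  apply: (@expR_pow_le _ _ _ 9); first lra.
  by rewrite !exprS expr0; lra.
have := @le_expR_tangent R s 7 (5/2) ltac:(lra) e7.
have : 49 * expR s <= expR s ^+ 3 by rewrite exprSr ler_wpM2r ?expR_ge0 // !exprS expr0; nra.
by lra.
Qed.

Lemma bin_le_exp2 (n k : nat) : ('C(n, k) <= 2 ^ n)%N.
Proof.
by rewrite -[n in 'C(n, k)]card_ord -card_draws -[n in (2 ^ n)%N]card_ord -cardsT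
  -card_powerset powersetT subset_leq_card // subsetT.
Qed.

(** The least [h] with [n <= m * 2 ^ h] is positive because [m < n], and minimality gives the upper
    bound. *)
Lemma exists_pow2_between (m n : nat) : (0 < m < n)%N ->
  exists h, (n <= m * 2 ^ h < n.*2)%N.
Proof.
move=> /andP[m0 mn]; have ex : exists h, (n <= m * 2 ^ h)%N.
  by exists n; apply: leq_trans (ltnW (ltn_expl n (ltnSn 1))) _; rewrite leq_pmull.
case: (ex_minnP ex) => h nh hmin; exists h; rewrite nh /=.
case: h nh hmin => [|h] nh hmin; first by rewrite muln1 in nh; rewrite leqNgt mn in nh.
rewrite expnS mulnCA mul2n ltn_double ltnNge; apply/negP => /hmin.
by rewrite ltnn.
Qed.

Section Numerics.
Variables (R : realType) (m n B : nat).
Hypothesis mn_ge3 : (3 <= maxn m n)%N.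
Hypothesis B_large : 6 * m%:R * ln (maxn m n)%:R <= B%:R :> R.

Let q := maxn m n.
Let lnq0 : 0 < ln q%:R :> R.
Proof. by rewrite ln_gt0 // (ltr_nat R 1) (leq_trans _ mn_ge3). Qed.

(** From [n <= 3 * m] follows [B >= 2n ln q], so [s = B / (2n)] satisfies [q <= expR s], and
    [expR_bound3] is raised to the power [n]. *)
Lemma box_card_le_expR : (0 < n)%N -> (n <= 3 * m)%N -> (B.+1 ^ n)%:R <= expR B%:R :> R.
Proof.
move=> n0 n3m; pose s : R := B%:R / (2 * n%:R).
have nR : 0 < n%:R :> R by rewrite ltr0n.
have lns : ln q%:R <= s.
  rewrite ler_pdivlMr ?mulr_gt0 //; apply: le_trans B_large.
  rewrite mulrC ler_wpM2r ?(ltW lnq0) //; move: n3m; rewrite -(ler_nat R) natrM; lra.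
have qs : q%:R <= expR s by rewrite -ler_expR lnK ?posrE ?ltr0n ?(leq_trans _ mn_ge3) in lns.
have ns : n%:R <= expR s by apply: le_trans qs; rewrite ler_nat leq_maxr.
have s0 : 0 <= s by apply: le_trans lns; exact: ltW.
have BE : B%:R = n%:R * (2 * s) by rewrite /s; field; rewrite gt_eqF.
rewrite BE expRM_natl natrX lerXn2r ?nnegrE ?expR_ge0 // -natr1 BE.
have := @expR_bound3 R s (le_trans _ qs); rewrite ler_nat => /(_ mn_ge3).
rewrite [2 * s]mulrC -[2]/(2%:R) expRM_natr; apply: le_trans.
rewrite lerD2r [leLHS]mulrC [s * 2%:R]mulrC ler_wpM2l //.
by rewrite mulr_ge0.
Qed.

(** With [X = 2 ^ h] and ['C(m.*2, m) <= 4 ^ m], the [m]-th root of the loss is at most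
    [8 X ^ 3 (B + 1)]; this is compared with [expR (6 s)], where [s = B / (6m) >= ln n]. *)
Lemma loss_le_expR (h : nat) : (0 < m)%N -> (3 * m < n)%N ->
  (n <= m * 2 ^ h < n.*2)%N ->
  (('C(m.*2, m) * 2 ^ m) ^ h.+1 * B.+1 ^ m)%:R <= expR B%:R :> R.
Proof.
move=> m0 m3n /andP[_ h2n].
have mR : 0 < m%:R :> R by rewrite ltr0n.
have nR : 0 < n%:R :> R by rewrite ltr0n (leq_ltn_trans _ m3n).
have qn : q = n by apply/maxn_idPr; lia.
pose s : R := B%:R / (6 * m%:R).
have lns : ln n%:R <= s.
  by rewrite ler_pdivlMr ?mulr_gt0 // mulrC -qn.
have ns : n%:R <= expR s by rewrite -ler_expR lnK ?posrE in lns.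
have s0 : 0 <= s by apply: le_trans lns; rewrite -qn; exact: ltW.
have BE : B%:R = m%:R * (s * 6%:R) by rewrite /s; field; rewrite gt_eqF.
pose X : R := (2 ^ h)%:R.
have X0 : 0 <= X by rewrite ler0n.
have mX : m%:R * X <= 2 * n%:R by rewrite -!natrM ler_nat mul2n ltnW.
(* For [m = 1] the exact factor 4 is kept, giving [4 X ^ 2] with [X <= 2n]; the bound [X <= n] used
   afterwards comes from [m >= 2]. *)
have [m1|m2] := eqVneq m 1%N.
  have -> : (('C(m.*2, m) * 2 ^ m) ^ h.+1 * B.+1 ^ m)%:R = 4 * X ^+ 2 * B.+1%:R :> R.
    have X2 : X ^+ 2 = 4 ^+ h by rewrite /X natrX -exprM mulnC exprM -natrX.
    by rewrite m1 (_ : 'C(1.*2, 1) * 2 ^ 1 = 4)%N // expn1 natrM natrX exprS X2.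
  have n4 : 4 <= expR s by apply: le_trans ns; rewrite ler_nat; lia.
  have := expR_bound4 n4.
  rewrite -[B.+1%:R]natr1 BE m1 mul1r expRM_natr; rewrite m1 mul1r in mX.
  have -> : expR s ^+ 6 = expR s ^+ 2 * expR s ^+ 4 by rewrite -exprD.
  move=> e4.
  apply: (@le_trans _ _ (n%:R ^+ 2 * (16 * (6 * s + 1)))).
    have X2 : X ^+ 2 <= 4 * n%:R ^+ 2 by rewrite !expr2; nra.
    have w0 : 0 <= 6 * s + 1 by lra.
    by have := ler_wpM2r w0 X2; lra.
  apply: ler_pM => //; first by rewrite exprn_ge0.
    by rewrite mulr_ge0 //; lra.
  by rewrite lerXn2r ?nnegrE ?expR_ge0.
have n7 : 7 <= expR s by apply: le_trans ns; rewrite ler_nat; lia.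
have e7 := expR_bound7 n7.
apply: (@le_trans _ _ ((8 * X ^+ 3 * B.+1%:R) ^+ m)).
  rewrite /X -!natrX -!natrM -natrX ler_nat [leqRHS]expnMn leq_mul2r; apply/orP; right.
  apply: (@leq_trans ((2 ^ (3 * m)) ^ h.+1)).
    rewrite leq_exp2r // mulSn addnC expnD leq_mul2r mul2n.
    by rewrite bin_le_exp2 orbT.
  by rewrite -!expnM -(expnD 2 3) -expnM; apply: eq_leq; congr (2 ^ _)%N; ring.
rewrite [in leRHS]BE expRM_natl lerXn2r ?nnegrE ?expR_ge0 ?mulr_ge0 ?exprn_ge0 //.
rewrite expRM_natr -[B.+1%:R]natr1 BE.
have -> : expR s ^+ 6 = expR s ^+ 3 * expR s ^+ 3 by rewrite -exprD.
have m2R : 2 <= m%:R :> R by rewrite (ler_nat R 2); lia.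
have Xn : X <= n%:R by nra.
apply: (@le_trans _ _ (n%:R ^+ 3 * (16 * (6 * s + 1)))); last first.
  apply: ler_pM => //; first by rewrite exprn_ge0.
    by rewrite mulr_ge0 //; lra.
  by rewrite lerXn2r ?nnegrE ?expR_ge0.
have X3 : X ^+ 3 * m%:R <= 2 * n%:R ^+ 3.
  have -> : X ^+ 3 * m%:R = X ^+ 2 * (m%:R * X) by ring.
  have -> : 2 * n%:R ^+ 3 = n%:R ^+ 2 * (2 * n%:R) :> R by ring.
  apply: ler_pM => //; rewrite ?exprn_ge0 ?mulr_ge0 //.
  by rewrite lerXn2r ?nnegrE.
apply: (@le_trans _ _ (8 * (X ^+ 3 * m%:R) * (6 * s + 1))).
  have mm : m%:R * (s * 6%:R) + 1 <= m%:R * (6 * s + 1) by lra.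
  by have := ler_wpM2l (exprn_ge0 3 X0) mm; lra.
have w0 : 0 <= 6 * s + 1 by lra.
by have := ler_wpM2r w0 X3; lra.
Qed.

End Numerics.

Theorem corollary1p2 (R : realType) (m n : nat) (M : 'M[int]_(m, n))
    (M_tu : totally_unimodular M) (mn_ge3 : (3 <= maxn m n)%N)
    (b : 'cV[int]_m)
    (b_large : 6 * m%:R * ln (maxn m n)%:R <= (l1norm b)%:R :> R)
    (b_fin : finite_set (nat_solutions M b)) :
  (num_solutions M b)%:R <= capacity R M b /\
  expR (- (l1norm b)%:R) * capacity R M b <= (num_solutions M b)%:R.
Proof.
rewrite num_solutionsE //; split; first by apply: le_capacity => u; exact: card_box_le.
have ua := totally_unimodular_family M_tu.
set B := l1norm b; set a := fun j => col j M in ua *; set N := #|_|.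
have capN (u : 'I_m -> R) := capacity_le M b u.
(* The tensor-power bound requires a nonempty fibre; for an empty one the capacity is at most 0. *)
have [N0|N0] := posnP N.
  apply: le_trans (ler0n _ _); rewrite mulr_ge0_le0 ?expR_ge0 //.
  by apply: (box_count0_capacity ua N0) => u; exact: capN.
suff : capacity R M b <= expR B%:R * N%:R.
  by rewrite expRN ler_pdivrMl ?expR_gt0.
(* At [x = 1] all [B.+1 ^ n] terms equal 1, and [N >= 1]. *)
have trivial : (B.+1 ^ n)%:R <= expR B%:R :> R -> capacity R M b <= expR B%:R * N%:R.
  move=> Bn; apply: le_trans (capN (fun=> 0)) _.
  rewrite (eq_bigr (fun=> 1)) => [|y _]; last first.
    by rewrite /dot big1 ?expR0 // => l _; rewrite mul0r.
  rewrite sumr_const card_ffun !card_ord -[leLHS]mulr1.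
  by apply: ler_pM => //; rewrite (ler_nat R 1).
have [n3m|m3n] := leqP n (3 * m).
  apply: trivial; have [->|n0] := posnP n; first by rewrite expn0 (le_trans _ (expR_ge1Dx _)) ?lerDl.
  exact: (box_card_le_expR mn_ge3 b_large).
(* For [m = 0] the norm [B] is an empty sum, so the box is a single point. *)
have [m0|m0] := posnP m.
  apply: trivial; rewrite (_ : B = 0%N) ?exp1n ?expR0 //.
  by rewrite /B /l1norm big1 // => -[i im] _; exfalso; move: im; rewrite m0.
have [|h hP] := @exists_pow2_between m n; first by rewrite m0; lia.
have := @box_count_capacity m B _ a b R h (capacity R M b) ua.
rewrite card_ord sum_count1 => /(_ _ _ capN).
have -> : #|[set y : {ffun 'I_n -> 'I_B.+1} | box_sum a y - b == 0]| = N.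
  by apply: eq_card => y; rewrite !inE subr_eq0.
case/andP: (hP) => nh _ /(_ nh N0) => /le_trans; apply.
by rewrite natrM ler_wpM2r //; exact: (loss_le_expR mn_ge3 b_large).
Qed.
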